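(* Consider the Lur'e system and its Krasovskii regularization $\dot x\in F(x)$ as in the context, and suppose Assumptions 1 and 2 hold. Then the origin is globally asymptotically stable: every maximal solution of $\dot x\in F(x)$ is defined on $\mathbb{R}_{\ge0}$, and there exists $\beta\in\mathcal{KL}$ such that every solution $x$ satisfies $|x(t)|\le\beta(|x(0)|,t)$ for all $t\ge0$.
   Context: System: $\dot x=Ax+Bu$, $y=Cx$, $u=-\boldsymbol\psi(y)$, $x\in\mathbb{R}^n$, $u,y\in\mathbb{R}^p$, $\boldsymbol\psi(y)=(\psi_1(y_1),\dots,\psi_p(y_p))$. A function $\mathbb{R}\to\mathbb{R}$ is piecewise continuous if on every bounded interval it has finitely many discontinuity points, is continuous between them, and has finite one-sided limits there. Krasovskii regularization: $\boldsymbol\Psi_i(s):=\bigcap_{\delta>0}\overline{\mathrm{co}}\,\psi_i(s+\delta[-1,1])$, $\boldsymbol\Psi(y):=\boldsymbol\Psi_1(y_1)\times\dots\times\boldsymbol\Psi_p(y_p)$, $F(x):=\{Ax-Bw:w\in\boldsymbol\Psi(Cx)\}$. A solution of $\dot x\in F(x)$ is an absolutely continuous function on an interval containing $0$ satisfying $\dot x(t)\in F(x(t))$ for almost every $t$. Assumption 1: for each $i$, $\psi_i$ is piecewise continuous and there is $\zeta_i\in(0,+\infty]$ with $\psi_i(s)(\psi_i(s)-\zeta_is)\le0$ for all $s$ (for $\zeta_i=+\infty$: $\psi_i(s)s\ge0$ for all $s$). $Z:=\mathrm{diag}(\zeta_1^{-1},\dots,\zeta_p^{-1})$, $(+\infty)^{-1}:=0$.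 Assumption 2: there exist a diagonal $\Gamma>0$, a symmetric $P>0$ and $\eta>0$ such that $$\begin{bmatrix}PA+A^\top P+\eta I_n & PB-(C+\Gamma CA)^\top\\ B^\top P-(C+\Gamma CA) & -2Z-\Gamma CB-(\Gamma CB)^\top\end{bmatrix}\le0.$$ $\mathcal{KL}$: functions $\beta(r,t)$ that are class-$\mathcal{K}$ in $r$ for each $t$ and nonincreasing to $0$ in $t$ for each $r$. *)

(* Defs.v *)
From HB Require Import structures.
From mathcomp Require Import all_boot all_order all_algebra.
From mathcomp Require Import all_classical all_reals all_analysis.
Set Implicit Arguments. Unset Strict Implicit. Unset Printing Implicit Defensive.
Import Order.TTheory GRing.Theory Num.Theory.
Import numFieldNormedType.Exports.
Local Open Scope classical_set_scope.
Local Open Scope ring_scope.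

Section Defs.
Variable R : realType.

Definition vnorm (n : nat) (v : 'cV[R]_n) : R := Num.sqrt (\sum_i (v i 0) ^+ 2).

Definition piecewise_continuous (f : R -> R) : Prop :=
  forall a b : R, exists s : seq R,
    (forall x, a <= x <= b -> x \notin s -> {for x, continuous f}) /\
    (forall x, x \in s -> a <= x <= b ->
       exists l r : R, f y @[y --> x^'-] --> l /\ f y @[y --> x^'+] --> r).

Definition convexR (C : set R) : Prop :=
  forall x y l, C x -> C y -> 0 <= l <= 1 -> C (l * x + (1 - l) * y).
Definition hullR (A : set R) : set R :=
  \bigcap_(C in [set C : set R | convexR C /\ A `<=` C]) C.

Definition krasovskii (f : R -> R) (s : R) : set R :=
  \bigcap_(d in [set d : R | 0 < d])
     closure (hullR (f @` [set y | s - d <= y <= s + d])).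

Definition Fk (n p : nat) (A : 'M[R]_n) (B : 'M[R]_(n, p)) (C : 'M[R]_(p, n))
    (psi : 'I_p -> R -> R) (x : 'cV[R]_n) : set 'cV[R]_n :=
  [set v | exists w : 'cV[R]_p,
      (forall i, krasovskii (psi i) ((C *m x) i 0) (w i 0)) /\
      v = A *m x - B *m w].

Definition abs_cont_on (n : nat) (a b : R) (x : R -> 'cV[R]_n) : Prop :=
  forall eps : R, 0 < eps -> exists2 delta : R, 0 < delta &
    forall (N : nat) (u v : nat -> R),
      (forall k, (k < N)%N -> a <= u k /\ u k <= v k /\ v k <= b) ->
      (forall k, (k.+1 < N)%N -> v k <= u k.+1) ->
      \sum_(k < N) (v k - u k) < delta ->
      \sum_(k < N) vnorm (x (v k) - x (u k)) < eps.

Definition vdiffble (n : nat) (x : R -> 'cV[R]_n) (t : R) : Prop :=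
  forall i : 'I_n, derivable (fun s => x s i 0) t 1.
Definition vderiv (n : nat) (x : R -> 'cV[R]_n) (t : R) : 'cV[R]_n :=
  \col_i derive1 (fun s => x s i 0) t.

Definition is_solution (n : nat) (F : 'cV[R]_n -> set 'cV[R]_n)
    (I : interval R) (x : R -> 'cV[R]_n) : Prop :=
  0 \in I /\
  (forall a b, a \in I -> b \in I -> abs_cont_on a b x) /\
  {ae (@lebesgue_measure R), forall t, [set` I] t ->
      vdiffble x t /\ F (x t) (vderiv x t)}.

Definition maximal_solution (n : nat) (F : 'cV[R]_n -> set 'cV[R]_n)
    (I : interval R) (x : R -> 'cV[R]_n) : Prop :=
  is_solution F I x /\
  forall (J : interval R) (y : R -> 'cV[R]_n),
    is_solution F J y -> [set` I] `<=` [set` J] ->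
    (forall t, t \in I -> y t = x t) -> [set` J] = [set` I].

Definition classK (f : R -> R) : Prop :=
  {within [set r : R | 0 <= r], continuous f} /\ f 0 = 0 /\
  (forall r s, 0 <= r -> r < s -> f r < f s).
Definition classKL (beta : R -> R -> R) : Prop :=
  (forall t, 0 <= t -> classK (fun r => beta r t)) /\
  (forall r, 0 <= r ->
     (forall s t, 0 <= s -> s <= t -> beta r t <= beta r s) /\
     beta r t @[t --> +oo] --> 0).

Definition zinv (z : \bar R) : R := if z is r%:E then r^-1 else 0.
Definition sector_cond (f : R -> R) (z : \bar R) : Prop :=
  match z with
  | r%:E => forall s, f s * (f s - r * s) <= 0
  | +oo%E => forall s, 0 <= f s * s
  | -oo%E => False
  end.
Definition assumption1 (p : nat) (psi : 'I_p -> R -> R) (zeta : 'I_p -> \bar R)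
  : Prop :=
  forall i, piecewise_continuous (psi i) /\ (0 < zeta i)%E /\
            sector_cond (psi i) (zeta i).

Definition neg_semidef (m : nat) (M : 'M[R]_m) : Prop :=
  forall v : 'cV[R]_m, (v^T *m M *m v) 0 0 <= 0.
Definition pos_def (m : nat) (M : 'M[R]_m) : Prop :=
  forall v : 'cV[R]_m, v != 0 -> 0 < (v^T *m M *m v) 0 0.
Definition assumption2 (n p : nat) (A : 'M[R]_n) (B : 'M[R]_(n, p))
    (C : 'M[R]_(p, n)) (zeta : 'I_p -> \bar R) : Prop :=
  let Z : 'M[R]_p := diag_mx (\row_i zinv (zeta i)) in
  exists (g : 'rV[R]_p) (P : 'M[R]_n) (eta : R),
    let G : 'M[R]_p := diag_mx g in
    (forall i, 0 < g 0 i) /\ P^T = P /\ pos_def P /\ 0 < eta /\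
    neg_semidef (block_mx
       (P *m A + A^T *m P + eta%:M) (P *m B - (C + G *m C *m A)^T)
       (B^T *m P - (C + G *m C *m A)) (- (2%:R *: Z) - G *m C *m B - (G *m C *m B)^T)).

End Defs.

(* Main.v *)
(* The Lur'e-Postnikov function V(x) = x'Px + 2 sum_i g_i int_0^(C_i x) psi_i is
   absolutely continuous along solutions. For almost every t each y_i = C_i x is
   either at a continuity point of psi_i or has zero derivative, because y_i
   crosses a given level with nonzero speed only countably often; hence the chain
   rule holds with any Krasovskii selection w, and the matrix inequality together
   with the sector condition yields V' <= - eta |x|^2 almost everywhere. If
   V(x) <= a(|x|) with a of class K, then on [0, t] the value |x(s)|^2 drops below
   (a(|x(0)|) / eta + |x(0)|^2) / (1 + t) at some s, and V decreases afterwards;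
   this is the KL estimate. Boundedness extends a solution to a missing right end
   point, and past an attained end point it is continued by a limit of Euler
   polygons. *)
Require Import Defs.
From HB Require Import structures.
From mathcomp Require Import all_boot all_order all_algebra.
From mathcomp Require Import all_classical all_reals all_analysis.
From mathcomp Require Import ring lra.
Import Order.TTheory GRing.Theory Num.Theory.
Import numFieldNormedType.Exports.
Local Open Scope classical_set_scope.
Local Open Scope ring_scope.

(** * Absolutely continuous functions with nonpositive derivative *)

(** Two obstacles shape the proof. The primitives of the nonlinearities may grow arbitrarily fast
    when some sector is unbounded, so V has no quadratic upper bound and V' <= - eta |x|^2 gives no
    rate of the form V' <= - c V. The estimate therefore comes from a time average of |x|^2, which
    explains the factor 1 / (1 + t). For existence, the slopes of the Euler polygons need not
    converge where a nonlinearity jumps. The accumulated contributions of the linear part and of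
    each nonlinearity are passed to the limit separately. The limits are Lipschitz, hence
    differentiable almost everywhere, and their derivatives are limits of averages of slopes. Such
    averages lie in closed convex hulls, and this is exactly what the Krasovskii regularization
    allows; the derivative of the nonlinear contribution is the selection w. Differential
    inequalities are integrated through one monotonicity statement for absolutely continuous
    functions, itself obtained from Cousin's lemma. *)

Lemma cousin (R : realType) (P : R -> R -> Prop) (a b : R) : a <= b ->
  (forall s t u, a <= s -> s <= t -> t <= u -> u <= b -> P s t -> P t u -> P s u) ->
  (forall t, a <= t <= b -> exists2 d, 0 < d & forall s u, a <= s -> s <= t ->
     t <= u -> u <= b -> t - s < d -> u - t < d -> P s u) ->
  P a b.
Proof.
move=> ab Padd Ploc.
(* The local property at [sup S] joins a point of [S] just below it to a point beyond it, unless [b]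
   comes first; so [b] itself is reached. *)
pose S := [set t | a <= t <= b /\ P a t].
have Sa : S a.
  split; first by rewrite lexx.
  have [|d d0 H] := Ploc a; first by rewrite lexx.
  by apply: H; rewrite ?lexx ?subrr.
have ubS : has_ubound S by exists b => t [/andP[_ ->]].
have hS : has_sup S by split; [exists a|].
have ac : a <= sup S by apply: sup_upper_bound.
have cb : sup S <= b by apply: ge_sup; [exists a|move=> t [/andP[_ ->]]].
have [|d d0 H] := Ploc (sup S); first by rewrite ac cb.
have [t [/andP[at_ tb] Pat] tc] := sup_adherent d0 hS.
have tS : t <= sup S by apply: sup_upper_bound => //; split; rewrite ?at_.
pose u := Num.min (sup S + d / 2) b.
have Su : sup S <= u by rewrite le_min cb andbT; lra.
have ub : u <= b by rewrite ge_min lexx orbT.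
have Pau : P a u.
  apply: (Padd a t u) => //; first exact: le_trans Su.
  apply: H => //; first lra.
  have : u <= sup S + d / 2 by rewrite ge_min lexx.
  lra.
have uS : u <= sup S.
  by apply: sup_upper_bound => //; split => //; rewrite ub andbT (le_trans ac).
suff -> : b = u by [].
apply/eqP; rewrite eq_le ub andbT.
move: uS; rewrite {1}/u ge_min => /orP[|bS]; first lra.
exact: le_trans Su.
Qed.

(** The scalar counterpart of [abs_cont_on]: the calculus is done on coordinates, outputs and the
    Lyapunov function. *)
Definition ac_on {R : realType} (a b : R) (f : R -> R) : Prop :=
  forall eps : R, 0 < eps -> exists2 delta : R, 0 < delta &
    forall (N : nat) (u v : nat -> R),
      (forall k, (k < N)%N -> a <= u k /\ u k <= v k /\ v k <= b) ->
      (forall k, (k.+1 < N)%N -> v k <= u k.+1) ->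
      \sum_(k < N) (v k - u k) < delta ->
      \sum_(k < N) `|f (v k) - f (u k)| < eps.

Lemma ae_mono (R : realType) (P Q : R -> Prop) : (forall t, P t -> Q t) ->
  {ae (@lebesgue_measure R), forall t, P t} ->
  {ae (@lebesgue_measure R), forall t, Q t}.
Proof. by move=> PQ; apply: negligibleS; apply: subsetC => t /=; exact: PQ. Qed.

Lemma ae_and (R : realType) (P Q : R -> Prop) :
  {ae (@lebesgue_measure R), forall t, P t} ->
  {ae (@lebesgue_measure R), forall t, Q t} ->
  {ae (@lebesgue_measure R), forall t, P t /\ Q t}.
Proof.
move=> aP aQ; have := negligibleU aP aQ.
by apply: negligibleS; rewrite -setCI.
Qed.

Lemma ae_ord (R : realType) (n : nat) (P : 'I_n -> R -> Prop) :
  (forall i, {ae (@lebesgue_measure R), forall t, P i t}) ->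
  {ae (@lebesgue_measure R), forall t, forall i, P i t}.
Proof.
move=> H.
have H' k : {ae (@lebesgue_measure R), forall t, forall kn : (k < n)%N, P (Ordinal kn) t}.
  have [kn|kn] := pselect (k < n)%N; last by apply: aeW => t kn'; case: kn.
  by apply: ae_mono (H (Ordinal kn)) => t Pt kn'; rewrite (bool_irrelevance kn' kn).
have := ae_foralln H'.
by apply: ae_mono => t Ht [k kn]; exact: Ht.
Qed.

Lemma ae_countable (R : realType) (A : set R) : countable A ->
  {ae (@lebesgue_measure R), forall t, ~ A t}.
Proof.
move=> cA; have A0 := countable_lebesgue_measure0 cA.
have mA : measurable A by exact: countable_measurable.
apply: (negligibleS _ (_ : (@lebesgue_measure R).-negligible A)).
  by move=> t /= /contrapT.
by exists A; split.
Qed.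

(** The interval straddles [t], as the tagged intervals of Cousin's lemma do; the increments over
    [[s, t]] and [[t, u]] are estimated separately and added. *)
Lemma derivable_le0_local (R : realType) (f : R -> R) (t e : R) :
  0 < e -> derivable f t 1 -> derive1 f t <= 0 ->
  exists2 d, 0 < d & forall s u, s <= t -> t <= u -> t - s < d -> u - t < d ->
    f u - f s <= e * (u - s).
Proof.
move=> e0 df f'0.
have /cvgr_dist_lt /(_ _ e0) := df.
move=> /nbhs_ballP[d /= d0 H].
exists d => // s u st tu sd ud.
have key h : `|h| < d -> h != 0 -> h^-1 * (f (t + h) - f t) < e.
  move=> hd h0.
  have := H h; rewrite /ball /= sub0r normrN => /(_ hd h0).
  rewrite -[lim _]/('D_1 f t) -derive1E ltr_distl.
  move=> /andP[+ _]; rewrite /GRing.scale /= mulr1 (addrC h t); lra.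
have H1 : f u - f t <= e * (u - t).
  have [->|ut] := eqVneq u t; first by rewrite !subrr mulr0.
  have ut0 : 0 < u - t by rewrite subr_gt0 lt_def ut tu.
  have := key (u - t); rewrite (ger0_norm (ltW ut0)) => /(_ ud).
  rewrite gt_eqF// => /(_ isT); rewrite (addrC t) subrK.
  by rewrite ltr_pdivrMl// => /ltW; rewrite mulrC.
have H2 : f t - f s <= e * (t - s).
  have [->|ut] := eqVneq t s; first by rewrite !subrr mulr0.
  have ut0 : 0 < t - s by rewrite subr_gt0 lt_def ut st.
  have := key (s - t); rewrite distrC (ger0_norm (ltW ut0)) => /(_ sd).
  rewrite subr_eq0 eq_sym ut => /(_ isT); rewrite (addrC t) subrK.
  by rewrite -opprB invrN mulNr -mulrN opprB ltr_pdivrMl// => /ltW; rewrite mulrC.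
have := lerD H1 H2; lra.
Qed.

(* The exceptional null set is covered by an open set U of small measure; by
   Cousin's lemma phi increases by at most e * (b - a) plus its variation over
   finitely many nonoverlapping intervals inside U, which is small by absolute
   continuity. *)
Lemma ac_nonincreasing (R : realType) (phi : R -> R) (a b : R) : a <= b ->
  ac_on a b phi ->
  {ae (@lebesgue_measure R), forall t, a <= t <= b ->
     derivable phi t 1 /\ derive1 phi t <= 0} ->
  phi b <= phi a.
Proof.
move=> ab acphi aeH.
have [N [mN muN NP]] : exists N : set R, [/\ measurable N,
    (@lebesgue_measure R N = 0)%E &
    ~` [set t | a <= t <= b -> derivable phi t 1 /\ derive1 phi t <= 0] `<=` N] := aeH.
apply/ler_addgt0Pr => e' e'0.
(* The good points cost [e * (b - a)] and the variation inside the open cover costs [e]; together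
   they make exactly [e']. *)
pose e := e' / (b - a + 1).
have ba1 : 0 < b - a + 1 by lra.
have e0 : 0 < e by rewrite divr_gt0.
have [delta delta0 Hac] := acphi _ e0.
have [|U [oU NU]] := @lebesgue_regularity_outer R N delta mN _ delta0.
  by apply: (@le_lt_trans _ _ 0%E); [rewrite le_eqVlt; apply/orP; left; apply/eqP; exact: muN|exact: ltry].
move=> muUN.
have mU : measurable U by exact: measurable_realfun.open_measurable.
have muU : (lebesgue_measure U < delta%:E)%E.
  rewrite (_ : U = (U `\` N) `|` N); last by rewrite setUC setDUK.
  apply: (le_lt_trans _ muUN).
  apply: (le_trans (measureU2 _ _ _)) => //; first exact: measurableD.
  by rewrite -[leRHS]adde0 leeD2l// le_eqVlt; apply/orP; left; apply/eqP; exact: muN.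
(* The lengths are compared with the measure of [U] in the half-open []s, u]], so that adjacent
   pieces are disjoint and the bounds add up. *)
pose P s u := exists n (p q : nat -> R),
  [/\ forall k, (k < n)%N -> s <= p k /\ p k <= q k /\ q k <= u,
      forall k, (k.+1 < n)%N -> q k <= p k.+1,
      ((\sum_(k < n) (q k - p k))%:E <= lebesgue_measure (U `&` `]s, u]))%E &
      phi u - phi s <= e * (u - s) + \sum_(k < n) `|phi (q k) - phi (p k)| ].
have : P a b.
  apply: cousin => //.
  - move=> s t u as_ st tu ub [n1 [p1 [q1 [A1 B1 C1 D1]]]] [n2 [p2 [q2 [A2 B2 C2 D2]]]].
    exists (n1 + n2)%N, (fun k => if (k < n1)%N then p1 k else p2 (k - n1)%N),
      (fun k => if (k < n1)%N then q1 k else q2 (k - n1)%N).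
    have sumE (F1 F2 : nat -> R) :
        \sum_(k < n1 + n2) (if (k < n1)%N then F1 k else F2 (k - n1)%N) =
        \sum_(k < n1) F1 k + \sum_(k < n2) F2 k.
      rewrite big_split_ord /=; congr (_ + _).
        by apply: eq_bigr => i _; rewrite ltn_ord.
      by apply: eq_bigr => i _; rewrite ltnNge leq_addr /= addKn.
    split.
    + move=> k kn; case: ifPn => k1.
        by have [? [? ?]] := A1 _ k1; split => //; split => //; exact: le_trans tu.
      have n1k : (n1 <= k)%N by rewrite leqNgt.
      have /A2[? [? ?]] : (k - n1 < n2)%N by rewrite ltn_subLR.
      by split => //; exact: le_trans st _.
    + move=> k kn; case: ifPn => k1; case: ifPn => k2.
      * exact: B1.
      * have [_ [_ /le_trans]] := A1 _ k1; apply.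
        have n1k : (n1 <= k.+1)%N by rewrite leqNgt.
        by have /A2[] : (k.+1 - n1 < n2)%N by rewrite ltn_subLR.
      * by move: k1; rewrite (ltn_trans (ltnSn k) k2).
      * have n1k : (n1 <= k)%N by rewrite leqNgt.
        rewrite (subSn n1k); apply: B2; rewrite -(subSn n1k).
        by rewrite ltn_subLR // (leq_trans n1k).
    + rewrite (eq_bigr (fun k : 'I_(n1 + n2) => if (k < n1)%N then q1 k - p1 k
          else q2 (k - n1)%N - p2 (k - n1)%N)); last by move=> i _; case: ifPn.
      rewrite (sumE (fun k => q1 k - p1 k) (fun k => q2 k - p2 k)).
      rewrite (_ : U `&` `]s, u] = (U `&` `]s, t]) `|` (U `&` `]t, u])); last first.
        rewrite -setIUr; congr (_ `&` _).
        by rewrite -itv_bndbnd_setU // bnd_simp.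
      rewrite measureU//; first last.
      * rewrite setIACA setIid.
        rewrite (_ : `]s, t] `&` `]t, u] = set0) ?setI0//.
        apply/seteqP; split => z //=; rewrite !in_itv /= => -[/andP[_ zt] /andP[tz _]].
        by move: (lt_le_trans tz zt); rewrite ltxx.
      * exact: measurableI.
      * exact: measurableI.
      by rewrite EFinD; apply: leeD.
    + rewrite (eq_bigr (fun k : 'I_(n1 + n2) => if (k < n1)%N then `|phi (q1 k) - phi (p1 k)|
          else `|phi (q2 (k - n1)%N) - phi (p2 (k - n1)%N)|)); last by move=> i _; case: ifPn.
      rewrite (sumE (fun k => `|phi (q1 k) - phi (p1 k)|) (fun k => `|phi (q2 k) - phi (p2 k)|)).
      have := lerD D1 D2; lra.
  - move=> t tab; have [tN|tN] := pselect (N t).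
    + have /nbhs_ballP[d /= d0 dU] : nbhs t U by apply: open_nbhs_nbhs; split => //; exact: NU.
      exists d => // s u as_ st tu ub sd ud.
      exists 1%N, (fun=> s), (fun=> u); split => //.
      * by move=> _ _; rewrite !lexx (le_trans st).
      * rewrite big_ord1 setIidr; last first.
          move=> z /=; rewrite in_itv /= => /andP[sz zu]; apply: dU.
          rewrite /ball /= ltr_distl; apply/andP; split; lra.
        by rewrite lebesgue_measure_itv /= lte_fin; case: ifPn => //; rewrite -leNgt lee_fin subr_le0.
      * rewrite big_ord1; apply: (le_trans (ler_norm _)).
        by rewrite lerDr mulr_ge0 ?subr_ge0 ?(le_trans st)// ltW.
    + have [df f'0] : derivable phi t 1 /\ derive1 phi t <= 0.
        by apply: contrapT => H; apply: tN; apply: NP => /= /(_ tab).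
      have [d d0 H] := derivable_le0_local _ _ _ _ e0 df f'0.
      exists d => // s u as_ st tu ub sd ud.
      exists 0%N, (fun=> s), (fun=> u); split => //.
      * by rewrite big_ord0 measure_ge0.
      * by rewrite big_ord0 addr0 H.
move=> [n [p [q [A1 B1 C1 D1]]]].
have /Hac : \sum_(k < n) (q k - p k) < delta.
  rewrite -lte_fin; apply: (le_lt_trans C1); apply: (le_lt_trans _ muU).
  by apply: le_measure; rewrite ?inE//; exact: measurableI.
move=> /(_ A1 B1) H.
have -> : e' = e * (b - a) + e by rewrite /e; field; rewrite gt_eqF.
lra.
Qed.

(** * Epsilon-delta forms of continuity, derivatives and one-sided limits *)

Lemma continuous_ed (R : realType) (f : R -> R) (x : R) :
  {for x, continuous f} <->
  forall e, 0 < e -> exists2 d, 0 < d & forall y, `|y - x| < d -> `|f y - f x| < e.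
Proof.
split.
- move=> cf e e0; have /cvgr_dist_lt /(_ _ e0) := cf.
  move=> /nbhs_ballP[d /= d0 H]; exists d => // y yd.
  by rewrite distrC; apply: (H y); rewrite /ball /= distrC.
- move=> H; apply/cvgrPdist_lt => e /H[d d0 Hd].
  apply/nbhs_ballP; exists d => //= y; rewrite /ball /= => yd.
  by rewrite distrC Hd // distrC.
Qed.

(** Existence and value of the derivative in one predicate; multiplying out the quotient and keeping
    the bound non-strict spares an exception at [s = t]. *)
Definition has_der {R : realType} (f : R -> R) (t D : R) : Prop :=
  forall e, 0 < e -> exists2 d, 0 < d &
    forall s, `|s - t| < d -> `|f s - f t - D * (s - t)| <= e * `|s - t|.

Lemma has_derP (R : realType) (f : R -> R) (t D : R) :
  has_der f t D <-> derivable f t 1 /\ derive1 f t = D.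
Proof.
have aux (e h : R) : h != 0 ->
  (`|D - h^-1 * (f (h + t) - f t)| <= e) = (`|f (h + t) - f t - D * h| <= e * `|h|).
  move=> h0; have h0' : 0 < `|h| by rewrite normr_gt0.
  rewrite -(ler_pM2r h0') -normrM distrC; congr (`|_| <= _).
  by field.
split.
- move=> H.
  suff K : h^-1 *: (f (h *: (1:R) + t) - f t) @[h --> (0:R)^'] --> D.
    by split; [apply/cvg_ex; exists D|rewrite derive1E; apply/cvg_lim].
  apply/cvgrPdist_le => e /H[d d0 Hd].
  apply/nbhs_ballP; exists d => //= h; rewrite /ball /= sub0r normrN => hd h0.
  rewrite /GRing.scale /= mulr1 aux//.
  by have := Hd (h + t); rewrite addrK; apply.
- move=> [df fD] e e0.
  have /cvgrPdist_le /(_ _ e0) := df.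
  move=> /nbhs_ballP[d /= d0 H]; exists d => // s sd.
  have [->|st] := eqVneq s t; first by rewrite !subrr mulr0 subr0 normr0 mulr0.
  have h0 : s - t != 0 by rewrite subr_eq0.
  have := H (s - t); rewrite /ball /= sub0r normrN => /(_ sd h0).
  by rewrite -[lim _]/('D_1 f t) -derive1E fD /GRing.scale /= mulr1 aux// subrK.
Qed.

Lemma has_der_congr (R : realType) (f g : R -> R) (t D d : R) : 0 < d ->
  (forall s, `|s - t| < d -> f s = g s) -> has_der f t D -> has_der g t D.
Proof.
move=> d0 fg fD e /fD[d' d'0 H]; exists (Num.min d d'); first by rewrite lt_min d0.
move=> s; rewrite lt_min => /andP[sd sd'].
by rewrite -!fg ?subrr ?normr0//; exact: H.
Qed.

Lemma ltr_dist_bounds (R : realType) (x y e : R) :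
  `|x - y| < e -> y - e < x /\ x < y + e.
Proof. by rewrite ltr_distl => /andP. Qed.

Lemma near_at_left_ed (R : realType) (f : R -> R) (t l e : R) : 0 < e ->
  f y @[y --> t^'-] --> l ->
  exists2 d, 0 < d & forall s, s < t -> t - s < d -> `|f s - l| < e.
Proof.
move=> e0 /cvgr_dist_lt /(_ _ e0) /nbhs_ballP[d /= d0 H].
exists d => // s st sd; rewrite distrC; apply: (H s) => //.
by rewrite /ball /= ger0_norm// subr_ge0 ltW.
Qed.

Lemma near_at_right_ed (R : realType) (f : R -> R) (t l e : R) : 0 < e ->
  f y @[y --> t^'+] --> l ->
  exists2 d, 0 < d & forall s, t < s -> s - t < d -> `|f s - l| < e.
Proof.
move=> e0 /cvgr_dist_lt /(_ _ e0) /nbhs_ballP[d /= d0 H].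
exists d => // s st sd; rewrite distrC; apply: (H s) => //.
by rewrite /ball /= distrC ger0_norm// subr_ge0 ltW.
Qed.

Lemma distrNN (R : realType) (x y : R) : `|- x - - y| = `|x - y|.
Proof. by rewrite -opprD normrN. Qed.

(** * Primitives of piecewise continuous functions *)

(** Near each point [f] is bounded by continuity, or by its one-sided limits together with its value
    there; Cousin's lemma turns the local bounds into one on the whole interval. *)
Lemma pc_bounded (R : realType) (f : R -> R) : piecewise_continuous f ->
  forall K, exists2 M, 0 <= M & forall x, `|x| <= K -> `|f x| <= M.
Proof.
move=> pcf K.
have [K0|K0] := ltP K 0.
  by exists 0 => // x xK; move: (le_trans (normr_ge0 x) xK); rewrite leNgt K0.
have [s [cs ls]] := pcf (- K) K.
have [M HM] : exists M, forall x, - K <= x -> x <= K -> `|f x| <= M.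
  apply: (@cousin _ (fun u v => exists M, forall x, u <= x -> x <= v -> `|f x| <= M)).
  - lra.
  - move=> u v w _ _ _ _ [M1 H1] [M2 H2]; exists (Num.max M1 M2) => x ux xw.
    rewrite le_max; have [xv|vx] := leP x v; first by rewrite H1.
    by rewrite H2 ?orbT// ltW.
  - move=> t tK; have [ts|ts] := boolP (t \in s).
    + have [l [r [fl fr]]] := ls t ts tK.
      have [d1 d10 H1] := near_at_left_ed _ _ _ _ _ ltr01 fl.
      have [d2 d20 H2] := near_at_right_ed _ _ _ _ _ ltr01 fr.
      exists (Num.min d1 d2); first by rewrite lt_min d10.
      move=> u v _ ut tv _; rewrite !lt_min => /andP[u1 u2] /andP[v1 v2].
      exists (`|l| + `|r| + `|f t| + 1) => x ux xv.
      have := normr_ge0 l; have := normr_ge0 r; have := normr_ge0 (f t) => ? ? ?.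
      have [xt|tx|->] := ltgtP x t; last lra.
      * have /H1 : x < t by []. 
        have -> : t - x < d1 by lra.
        move=> /(_ isT); have := ler_normD (f x - l) l; rewrite subrK; lra.
      * have /H2 : t < x by []. 
        have -> : x - t < d2 by lra.
        move=> /(_ isT); have := ler_normD (f x - r) r; rewrite subrK; lra.
    + have /continuous_ed /(_ _ ltr01) [d d0 H] := cs t tK ts.
      exists d => // u v _ ut tv _ du dv; exists (`|f t| + 1) => x ux xv.
      have /H : `|x - t| < d by rewrite ltr_distl; apply/andP; split; lra.
      have := ler_normD (f x - f t) (f t); rewrite subrK; lra.
exists `|M| => // x; rewrite ler_norml => /andP[? ?].
by apply: (le_trans (HM x _ _)) => //; exact: ler_norm.
Qed.

(** The finite exceptional lists of the intervals from [-n] to [n] are collected. Openness of [U]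
    gives measurability of [f] on it, and countability makes the rest null. *)
Lemma pc_countable_disc (R : realType) (f : R -> R) : piecewise_continuous f ->
  exists2 U : set R, open U & countable (~` U) /\
    forall x, U x -> {for x, continuous f}.
Proof.
move=> pcf.
have /choice[s Hs] : forall n : nat, exists s : seq R,
    forall x, - n%:R <= x <= n%:R -> x \notin s -> {for x, continuous f}.
  by move=> n; have [s [cs _]] := pcf (- n%:R) n%:R; exists s.
pose U (n : nat) := `](- n%:R : R), n%:R[%classic `&` ~` [set` s n].
exists (\bigcup_n U n).
  apply: bigcup_open => n _; apply: openI; first exact: interval_open.
  apply: closed_openC; apply: (@accessible_finite_set_closed R).1; last exact: finite_seq.
  exact/hausdorff_accessible/Rhausdorff.
split.
- apply: (@sub_countable _ _ _ (\bigcup_n [set` s n])).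
    apply: subset_card_le => x /= Ux.
    exists (Num.truncn `|x|).+1 => //=; apply: contrapT => xs; apply: Ux.
    exists (Num.truncn `|x|).+1 => //; split => //=.
    by rewrite in_itv /= -ltr_norml truncnS_gt.
  by apply: bigcup_countable => // n _; apply: finite_set_countable; exact: finite_seq.
- move=> x [n _ [/= xn xs]]; apply: (Hs n); last exact/negP.
  by move: xn; rewrite in_itv /= => /andP[/ltW -> /ltW ->].
Qed.

Lemma pc_measurable (R : realType) (f : R -> R) : piecewise_continuous f ->
  measurable_fun [set: R] f.
Proof.
move=> /pc_countable_disc[U oU [cU fU]].
have mU : measurable U by exact: measurable_realfun.open_measurable.
rewrite -(setUv U); apply/measurable_funU => //; first exact: measurableC.
split.
  apply: measurable_realfun.open_continuous_measurable_fun => // x.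
  by rewrite inE; exact: fU.
move=> _ Y mY; apply: countable_measurable.
  exact: measurable_set1.
by apply: sub_countable cU; apply: subset_card_le => x [].
Qed.

(** This reflection reduces primitives on the negative half-line to those on the positive one. *)
Lemma pc_oppr (R : realType) (f : R -> R) : piecewise_continuous f ->
  piecewise_continuous (fun s => - f (- s)).
Proof.
move=> pcf a b; have [s [cs ls]] := pcf (- b) (- a).
exists (map -%R s); split.
- move=> x /andP[ax xb] xs.
  have /continuous_ed cfx : {for - x, continuous f}.
    apply: cs; first by rewrite !lerN2 ax xb.
    by apply: contra xs => xs; rewrite -[x]opprK map_f.
  apply/continuous_ed => e /cfx[d d0 H]; exists d => // y yd.
  by rewrite distrNN H// distrNN.
- move=> x /mapP[y ys ->] /andP[ay yb].
  have [l [r [fl fr]]] := ls y ys ltac:(lra).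
  exists (- r), (- l); split; apply: cvgN.
  + apply/cvgrPdist_lt => e e0.
    have [d d0 H] := near_at_right_ed _ _ _ _ _ e0 fr.
    apply/nbhs_ballP; exists d => //= z; rewrite /ball /= => zd zy.
    rewrite distrC; apply: H; first lra.
    by move: zd; rewrite ltr_norml; lra.
  + apply/cvgrPdist_lt => e e0.
    have [d d0 H] := near_at_left_ed _ _ _ _ _ e0 fl.
    apply/nbhs_ballP; exists d => //= z; rewrite /ball /= => zd zy.
    rewrite distrC; apply: H; first lra.
    by move: zd; rewrite ltr_norml; lra.
Qed.

Definition half_prim {R : realType} (f : R -> R) (y : R) : R :=
  (\int[lebesgue_measure]_(t in `[0%R, y]) f t)%R.

Lemma half_prim_le0 (R : realType) (f : R -> R) y : y <= 0 -> half_prim f y = 0.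
Proof.
rewrite /half_prim le_eqVlt => /orP[/eqP->|y0].
  by rewrite set_itv1 Rintegral_set1.
by rewrite set_itv_ge ?Rintegral_set0// bnd_simp -ltNge.
Qed.

Lemma pc_integrable (R : realType) (f : R -> R) : piecewise_continuous f ->
  forall u, (@lebesgue_measure R).-integrable `[0, u] (EFin \o f).
Proof.
move=> pcf u; apply: measurable_bounded_integrable.
- exact: measurable_itv.
- by rewrite /= lebesgue_measure_itv/=; case: ifP => _; rewrite ?ltry// -EFinB ltry.
- by apply: measurable_funTS; exact: pc_measurable.
- have [M M0 HM] := pc_bounded _ _ pcf u.
  exists M; split; first exact: num_real.
  move=> x Mx y /=; rewrite in_itv /= => /andP[y0 yu].
  by rewrite (le_trans _ (ltW Mx))// HM// ger0_norm.
Qed.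

Lemma half_prim_lip (R : realType) (f : R -> R) (K M : R) : piecewise_continuous f ->
  0 <= M -> (forall x, 0 <= x -> x <= K -> `|f x| <= M) ->
  forall u v, u <= v -> v <= K -> `|half_prim f v - half_prim f u| <= M * (v - u).
Proof.
move=> pcf M0 HM.
have key u v : 0 <= u -> u <= v -> v <= K ->
    `|half_prim f v - half_prim f u| <= M * (v - u).
  move=> u0 uv vK; rewrite /half_prim Rintegral_itvB//; last exact: pc_integrable.
  have iuv : (@lebesgue_measure R).-integrable `]u, v] (EFin \o f).
    apply: (integrableS _ _ _ (pc_integrable _ _ pcf v)); [exact: measurable_itv..|].
    by move=> x /=; rewrite !in_itv /= => /andP[ux ->]; rewrite (le_trans u0 (ltW ux)).
  apply: (le_trans (le_normr_Rintegral _ iuv)); first exact: measurable_itv.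
  apply: (@le_trans _ _ (\int[lebesgue_measure]_(x in `]u, v]) M)%R).
    apply: le_Rintegral => //.
    - by have := integrable_norm iuv.
    - apply: measurable_bounded_integrable.
      + exact: measurable_itv.
      + by rewrite /= lebesgue_measure_itv/=; case: ifP => _; rewrite ?ltry// -EFinB ltry.
      + exact: measurable_cst.
      + by exists M; split; [exact: num_real|move=> x Mx y _; rewrite ger0_norm// ltW].
    - move=> x /=; rewrite in_itv /= => /andP[ux xv].
      by apply: HM; [rewrite (le_trans u0 (ltW ux))|rewrite (le_trans xv)].
  rewrite Rintegral_cst; last exact: measurable_itv.
  rewrite /= lebesgue_measure_itv /= lte_fin; case: ltP => uv' //=.
  by rewrite mulr0 mulr_ge0// subr_ge0.
move=> u v uv vK; have [u0|u0] := leP 0 u; first exact: key.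
rewrite (half_prim_le0 _ f u (ltW u0)).
have [v0|v0] := leP v 0.
  by rewrite half_prim_le0// subrr normr0 mulr_ge0// subr_ge0.
have := key 0 v (lexx _) (ltW v0) vK; rewrite (half_prim_le0 _ f 0)// !subr0 => /le_trans; apply.
by rewrite ler_wpM2l//; lra.
Qed.

Lemma half_prim_der (R : realType) (f : R -> R) : piecewise_continuous f ->
  forall y, 0 < y -> {for y, continuous f} -> has_der (half_prim f) y (f y).
Proof.
move=> pcf y y0 cf; apply/has_derP.
apply: (@continuous_FTC1_closed _ f 0 y (y + 1)) => //; first lra.
exact: pc_integrable.
Qed.

(* Since half_prim vanishes on the negative half-line, this is the signed integral
   of f from 0 to y. *)
Definition prim {R : realType} (f : R -> R) (y : R) : R :=
  half_prim f y + half_prim (fun s => - f (- s)) (- y).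

Lemma prim0 (R : realType) (f : R -> R) : prim f 0 = 0.
Proof. by rewrite /prim oppr0 !half_prim_le0// addr0. Qed.

Lemma prim_lip (R : realType) (f : R -> R) : piecewise_continuous f ->
  forall K, exists2 M, 0 <= M & forall u v, `|u| <= K -> `|v| <= K ->
    `|prim f v - prim f u| <= M * `|v - u|.
Proof.
move=> pcf K; have [M M0 HM] := pc_bounded _ _ pcf K.
have pcf' := pc_oppr _ _ pcf.
exists (2 * M); first by rewrite mulr_ge0.
suff key u v : u <= v -> `|u| <= K -> `|v| <= K ->
    `|prim f v - prim f u| <= 2 * M * (v - u).
  move=> u v uK vK; have [uv|vu] := leP u v.
    by rewrite [X in _ <= _ * X]ger0_norm ?subr_ge0// key.
  rewrite distrC [X in _ <= _ * X]distrC [X in _ <= _ * X]ger0_norm.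
    exact: key (ltW vu) _ _.
  by rewrite subr_ge0 ltW.
move=> uv uK vK.
have H1 := half_prim_lip _ _ K M pcf M0 (fun x x0 xK => HM x (ltac:(rewrite ger0_norm//))) u v uv
  (le_trans (ler_norm _) vK).
have H2 : `|half_prim (fun s => - f (- s)) (- u) - half_prim (fun s => - f (- s)) (- v)| <= M * (- u - - v).
  apply: (half_prim_lip _ _ K M pcf' M0).
  - by move=> x x0 xK; rewrite normrN HM// normrN ger0_norm.
  - by rewrite lerN2.
  - by rewrite (le_trans _ uK)// -normrN ler_norm.
rewrite /prim opprD addrACA (le_trans (ler_normD _ _))//.
rewrite distrC in H2; lra.
Qed.

(** On either side of 0 one of the two halves of [prim] vanishes nearby, so only the other one is
    differentiated. *)
Lemma prim_der (R : realType) (f : R -> R) : piecewise_continuous f ->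
  forall y, y != 0 -> {for y, continuous f} -> has_der (prim f) y (f y).
Proof.
move=> pcf y y0 cf; have [yn|yp|y00] := ltgtP y 0; last by rewrite y00 eqxx in y0.
- have cg : {for - y, continuous (fun s => - f (- s))}.
    move/continuous_ed : cf => cf; apply/continuous_ed => e /cf[d d0 H].
    exists d => // s sd; rewrite distrNN (opprK y); apply: H.
    by rewrite -distrNN (opprK s).
  have y1 : 0 < - y by rewrite oppr_gt0.
  have dg := half_prim_der _ _ (pc_oppr _ _ pcf) _ y1 cg.
  apply: (has_der_congr _ (fun s => half_prim (fun s => - f (- s)) (- s)) _ _ _ _ y1).
    move=> s /ltr_dist_bounds[_ sy]; rewrite /prim (half_prim_le0 _ f s) ?add0r//; lra.
  move=> e /dg[d d0 H]; exists d => // s sd.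
  have := H (- s); rewrite distrNN => /(_ sd).
  by rewrite !opprK; congr (`|_| <= _); ring.
- have dg := half_prim_der _ _ pcf _ yp cf.
  apply: (has_der_congr _ _ _ _ _ _ yp _ dg).
  move=> s /ltr_dist_bounds[sy _]; rewrite /prim (half_prim_le0 _ _ (- s)) ?addr0//; lra.
Qed.

(** * The Krasovskii regularization and the chain rule *)

Lemma hullR_min (R : realType) (A C : set R) : convexR C -> A `<=` C -> hullR A `<=` C.
Proof. by move=> cC AC x; apply; split. Qed.

(** A half-line is convex and closed, so a bound for [f] on one window passes to the closed hull of
    its values. *)
Lemma krasovskii_le (R : realType) (f : R -> R) (s w d M : R) : 0 < d ->
  (forall y, s - d <= y -> y <= s + d -> f y <= M) -> krasovskii f s w -> w <= M.
Proof.
move=> d0 fM /(_ _ d0) kw.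
have cM : closed [set x : R | x <= M] by exact: closed_le.
suff : [set x : R | x <= M] w by [].
rewrite ((closure_id [set x : R | x <= M]).1 cM).
apply: closureS kw; apply: hullR_min.
- move=> x y l /= xM yM /andP[l0 l1].
  have -> : M = l * M + (1 - l) * M by ring.
  by rewrite lerD// ler_wpM2l// subr_ge0.
- by move=> _ [y /= /andP[y1 y2] <-]; exact: fM.
Qed.

Lemma krasovskii_ge (R : realType) (f : R -> R) (s w d M : R) : 0 < d ->
  (forall y, s - d <= y -> y <= s + d -> M <= f y) -> krasovskii f s w -> M <= w.
Proof.
move=> d0 fM /(_ _ d0) kw.
have cM : closed [set x : R | M <= x] by exact: closed_ge.
suff : [set x : R | M <= x] w by [].
rewrite ((closure_id [set x : R | M <= x]).1 cM).
apply: closureS kw; apply: hullR_min.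
- move=> x y l /= xM yM /andP[l0 l1].
  have -> : M = l * M + (1 - l) * M by ring.
  by rewrite lerD// ler_wpM2l// subr_ge0.
- by move=> _ [y /= /andP[y1 y2] <-]; exact: fM.
Qed.

Lemma krasovskii_continuous (R : realType) (f : R -> R) (s w : R) :
  {for s, continuous f} -> krasovskii f s w -> w = f s.
Proof.
move=> /continuous_ed cf kw.
have H e : 0 < e -> f s - e <= w /\ w <= f s + e.
  move=> /cf[d d0 H].
  have H' y : s - d / 2 <= y -> y <= s + d / 2 -> f s - e <= f y /\ f y <= f s + e.
    move=> y1 y2; have /H/ltr_dist_bounds[? ?] : `|y - s| < d.
      by rewrite ltr_distl; apply/andP; split; lra.
    by split; exact: ltW.
  have d20 : 0 < d / 2 by rewrite divr_gt0.
  split.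
  - by apply: krasovskii_ge d20 _ kw => y y1 y2; have [] := H' y y1 y2.
  - by apply: krasovskii_le d20 _ kw => y y1 y2; have [] := H' y y1 y2.
apply/eqP; rewrite eq_le; apply/andP; split; apply/ler_addgt0Pr => e /H[]; lra.
Qed.

Lemma krasovskii_bounded (R : realType) (f : R -> R) : piecewise_continuous f ->
  forall K, exists2 M, 0 <= M &
    forall s w, `|s| <= K -> krasovskii f s w -> `|w| <= M.
Proof.
move=> pcf K; have [M M0 HM] := pc_bounded _ _ pcf (K + 1).
exists M => // s w sK kw.
have H y : s - 1 <= y -> y <= s + 1 -> - M <= f y /\ f y <= M.
  move=> y1 y2; apply/andP; rewrite -ler_norml; apply: HM.
  have -> : y = (y - s) + s by rewrite subrK.
  apply: (le_trans (ler_normD _ _)).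
  have : `|y - s| <= 1 by rewrite ler_distl; apply/andP; split; lra.
  lra.
rewrite ler_norml; apply/andP; split.
- by apply: krasovskii_ge ltr01 _ kw => y y1 y2; have [] := H y y1 y2.
- by apply: krasovskii_le ltr01 _ kw => y y1 y2; have [] := H y y1 y2.
Qed.

(** For finite [z] the sector puts [f y] between 0 and [r * y], hence [w] between 0 and [r * s] as
    the window shrinks. For infinite [z] and [s] nonzero, [f] keeps the sign of [s] on a window of
    radius [|s| / 2], and so does [w]. *)
Lemma krasovskii_sector (R : realType) (f : R -> R) (z : \bar R) (s w : R) :
  (0 < z)%E -> sector_cond f z -> krasovskii f s w -> 0 <= w * (s - zinv z * w).
Proof.
case: z => [r| |] //=.
- rewrite lte_fin => r0 sc kw.
  have lo d : 0 < d -> Num.min 0 (r * s) - r * d <= w.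
    move=> d0; have rd : 0 <= r * d by apply: mulr_ge0; exact: ltW.
    apply: krasovskii_ge d0 _ kw => y y1 y2.
    have m1 : Num.min 0 (r * s) <= 0 by rewrite ge_min lexx.
    have m2 : Num.min 0 (r * s) <= r * s by rewrite ge_min lexx orbT.
    rewrite leNgt; apply/negP => H.
    have := sc y; rewrite leNgt => /negP; apply.
    rewrite nmulr_rgt0; last lra.
    rewrite subr_lt0; apply: (lt_le_trans H).
    have : r * (s - d) <= r * y by rewrite ler_pM2l.
    rewrite mulrBr; lra.
  have up d : 0 < d -> w <= Num.max 0 (r * s) + r * d.
    move=> d0; have rd : 0 <= r * d by apply: mulr_ge0; exact: ltW.
    apply: krasovskii_le d0 _ kw => y y1 y2.
    have m1 : 0 <= Num.max 0 (r * s) by rewrite le_max lexx.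
    have m2 : r * s <= Num.max 0 (r * s) by rewrite le_max lexx orbT.
    rewrite leNgt; apply/negP => H.
    have := sc y; rewrite leNgt => /negP; apply.
    rewrite pmulr_rgt0; last lra.
    rewrite subr_gt0; apply: (le_lt_trans _ H).
    have : r * y <= r * (s + d) by rewrite ler_pM2l.
    rewrite mulrDr; lra.
  have lo' : Num.min 0 (r * s) <= w.
    apply/ler_addgt0Pr => e e0; have := lo (e / r) (divr_gt0 e0 r0).
    by rewrite mulrCA divff ?gt_eqF// mulr1 lerBlDr.
  have up' : w <= Num.max 0 (r * s).
    apply/ler_addgt0Pr => e e0; have := up (e / r) (divr_gt0 e0 r0).
    by rewrite mulrCA divff ?gt_eqF// mulr1.
  have -> : s - r^-1 * w = r^-1 * (r * s - w) by field; rewrite gt_eqF.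
  rewrite mulrCA mulr_ge0 ?invr_ge0 ?(ltW r0)//.
  move: lo' up'; rewrite ge_min le_max => lo' up'.
  have [w0|w0|->] := ltgtP w 0; last by rewrite mul0r.
  + by apply: mulr_le0; [exact: ltW|rewrite subr_le0; move: lo'; rewrite leNgt w0].
  + by apply: mulr_ge0; [exact: ltW|rewrite subr_ge0; move: up'; rewrite leNgt w0].
- move=> _ sc kw; rewrite mul0r subr0.
  have [s0|s0|->] := ltgtP s 0; last by rewrite mulr0.
  + have d0 : 0 < - s / 2 by lra.
    have w0 : w <= 0.
      apply: krasovskii_le d0 _ kw => y y1 y2.
      by have := sc y; rewrite nmulr_lge0//; lra.
    by rewrite mulr_le0// ltW.
  + have d0 : 0 < s / 2 by lra.
    have w0 : 0 <= w.
      apply: krasovskii_ge d0 _ kw => y y1 y2.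
      by have := sc y; rewrite pmulr_lge0//; lra.
    by rewrite mulr_ge0// ltW.
Qed.

Lemma has_der_comp (R : realType) (f g : R -> R) (t D E : R) :
  has_der f t D -> has_der g (f t) E -> has_der (g \o f) t (E * D).
Proof.
move=> /has_derP[df fD] /has_derP[dg gE]; apply/has_derP; split.
  by apply/derivable1_diffP/differentiable_comp; exact/derivable1_diffP.
by rewrite derive1_comp// fD gE.
Qed.

(* A level is attained at isolated times wherever it is crossed with nonzero speed. *)
Lemma countable_crossings (R : realType) (y : R -> R) (c : R) :
  countable [set t | y t = c /\ exists2 D, D != 0 & has_der y t D].
Proof.
pose S (k : nat) := [set t | y t = c /\
  forall s, `|s - t| < k.+1%:R^-1 -> y s = c -> s = t].
apply: (@sub_countable _ _ _ (\bigcup_k S k)).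
  apply: subset_card_le => t [yt [D D0 yD]].
  (* A second time [s] at level [c] close to [t] would satisfy [|D| * |s - t| <= |D| / 2 * |s - t|],
     which forces [s = t]. *)
  have D20 : 0 < `|D| / 2 by rewrite divr_gt0// normr_gt0.
  have [d d0 H] := yD _ D20.
  have [k kd] : exists k : nat, k.+1%:R^-1 < d.
    exists (Num.truncn d^-1); rewrite invf_plt ?posrE//.
    exact: truncnS_gt.
  exists k => //; split => // s sk ys.
  have := H s (lt_trans sk kd); rewrite ys yt subrr sub0r normrN normrM.
  move=> H'; apply/eqP; rewrite -subr_eq0 -normr_eq0.
  rewrite eq_le normr_ge0 andbT.
  have Dn : 0 < `|D| by rewrite normr_gt0.
  rewrite -(@pmulr_rle0 _ (`|D| / 2))//; lra.
apply: bigcup_countable => // k _.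
(* Two points of [S k] in the same grid cell of length [1 / (k + 1)] coincide, so the index of the
   cell is injective. *)
apply/countable_injP; exists (fun t => pickle (Num.floor (t * k.+1%:R))).
move=> t u; rewrite !inE => -[yt Ht] [yu Hu] /(pcan_inj pickleK) ftu.
apply: Hu => //.
have k0 : (0:R) < k.+1%:R by rewrite ltr0n.
have := floor_le_tmp (t * k.+1%:R); have := floorD1_gt (t * k.+1%:R).
have := floor_le_tmp (u * k.+1%:R); have := floorD1_gt (u * k.+1%:R).
rewrite ftu intrD => *.
rewrite -(ltr_pM2r k0) mulVf ?gt_eqF//.
have -> : `|t - u| * k.+1%:R = `|t * k.+1%:R - u * k.+1%:R|.
  by rewrite -mulrBl normrM (ger0_norm (ltW k0)).
rewrite ltr_distl.
by apply/andP; split; lra.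
Qed.

Lemma chain_ae (R : realType) (f y : R -> R) (K : R) : piecewise_continuous f ->
  {ae (@lebesgue_measure R), forall t, `|y t| <= K -> forall D w,
    has_der y t D -> krasovskii f (y t) w ->
    has_der (prim f \o y) t (w * D)}.
Proof.
move=> pcf; have [s [cs _]] := pcf (- K) K.
pose S (c : R) := [set t | y t = c /\ exists2 D, D != 0 & has_der y t D].
(* The level 0 joins the discontinuities because [prim_der] does not cover it. *)
have cS : countable (\bigcup_(c in [set` 0 :: s]) S c).
  apply: bigcup_countable; first by apply: finite_set_countable; exact: finite_seq.
  by move=> c _; exact: countable_crossings.
apply: ae_mono (ae_countable _ _ cS) => t tS ytK D w yD kw.
have [yt|] := boolP (y t \in 0 :: s); last first.
  rewrite inE negb_or => /andP[yt0 yts].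
  have cf : {for y t, continuous f} by apply: cs => //; rewrite -ler_norml.
  rewrite (krasovskii_continuous _ _ _ _ cf kw).
  by apply: has_der_comp => //; exact: prim_der.
have D0 : D = 0.
  apply: contrapT => /eqP D0; apply: tS; exists (y t) => //=.
  by split => //; exists D.
(* Once [D = 0], the composition has derivative 0 whatever [w] is, because [prim f] is Lipschitz on
   bounded sets. Capping [e'] at 1 keeps [y u] within [K + 1], where [M] is a Lipschitz constant. *)
rewrite D0 in yD *; rewrite mulr0 => e e0.
have [M M0 HM] := prim_lip _ _ pcf (K + 1).
have M1 : 0 < M + 1 by lra.
pose e' := Num.min (e / (M + 1)) 1.
have e'0 : 0 < e' by rewrite lt_min divr_gt0//= ltr01.
have [d d0 H] := yD _ e'0.
exists (Num.min d 1); first by rewrite lt_min d0 ltr01.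
move=> u; rewrite lt_min => /andP[ud u1].
have := H u ud; rewrite !mul0r !subr0 => yu.
have e'1 : e' <= 1 by rewrite ge_min lexx orbT.
have e'e : e' <= e / (M + 1) by rewrite ge_min lexx.
have yu1 : `|y u - y t| <= 1.
  apply: (le_trans yu); have := normr_ge0 (u - t) => ?; apply: mulr_ile1 => //; exact: ltW.
have yuK : `|y u| <= K + 1.
  have := ler_normD (y u - y t) (y t); rewrite subrK; lra.
apply: (le_trans (HM _ _ _ yuK)); first lra.
apply: (@le_trans _ _ ((M + 1) * (e' * `|u - t|))).
  by apply: ler_pM => //; lra.
rewrite mulrA ler_wpM2r//.
by rewrite mulrC -ler_pdivlMr.
Qed.

(** * Calculus of derivatives and of absolutely continuous functions *)

Lemma has_der_is_derive (R : realType) (f : R -> R) (t D : R) :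
  has_der f t D <-> is_derive t (1 : R) f D.
Proof.
split; first by move=> /has_derP[df <-]; split=> //; rewrite derive1E.
by move=> [df <-]; apply/has_derP; rewrite derive1E.
Qed.

Lemma has_der_cst (R : realType) (c t : R) : has_der (fun=> c) t 0.
Proof.
by move=> e e0; exists 1 => // s _; rewrite subrr mul0r subr0 normr0 mulr_ge0// ltW.
Qed.

Lemma has_derD (R : realType) (f g : R -> R) (t D E : R) :
  has_der f t D -> has_der g t E -> has_der (fun s => f s + g s) t (D + E).
Proof.
move=> fD gE e e0.
have e20 : 0 < e / 2 by rewrite divr_gt0.
have [d1 d10 H1] := fD _ e20; have [d2 d20 H2] := gE _ e20.
exists (Num.min d1 d2); first by rewrite lt_min d10.
move=> s; rewrite lt_min => /andP[/H1 {}H1 /H2 {}H2].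
have -> : f s + g s - (f t + g t) - (D + E) * (s - t) =
  (f s - f t - D * (s - t)) + (g s - g t - E * (s - t)) by ring.
apply: (le_trans (ler_normD _ _)); lra.
Qed.

Lemma has_derM (R : realType) (f g : R -> R) (t D E : R) :
  has_der f t D -> has_der g t E -> has_der (fun s => f s * g s) t (f t * E + g t * D).
Proof.
by move=> /has_der_is_derive fD /has_der_is_derive gE; apply/has_der_is_derive; exact: is_deriveM.
Qed.

Lemma has_derZ (R : realType) (f : R -> R) (c t D : R) :
  has_der f t D -> has_der (fun s => c * f s) t (c * D).
Proof.
move=> fD; have := has_derM _ _ _ _ _ _ (has_der_cst _ c t) fD.
by rewrite mulr0 addr0.
Qed.

Lemma has_der_sum (R : realType) (I : Type) (r : seq I) (f : I -> R -> R) (D : I -> R) (t : R) :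
  (forall i, has_der (f i) t (D i)) ->
  has_der (fun s => \sum_(i <- r) f i s) t (\sum_(i <- r) D i).
Proof.
move=> H; elim: r => [|i r IH].
  rewrite big_nil (_ : (fun s => _) = (fun=> 0)); first exact: has_der_cst.
  by apply/funext => s; rewrite big_nil.
rewrite big_cons (_ : (fun s => _) = (fun s => f i s + \sum_(j <- r) f j s)).
  exact: has_derD.
by apply/funext => s; rewrite big_cons.
Qed.

(** Sums, products and Lipschitz images all reduce to this domination of increments. *)
Lemma ac_on_dom2 (R : realType) (a b K : R) (f g phi : R -> R) :
  ac_on a b f -> ac_on a b g ->
  (forall u v, a <= u -> u <= v -> v <= b ->
     `|phi v - phi u| <= K * (`|f v - f u| + `|g v - g u|)) ->
  ac_on a b phi.
Proof.
move=> acf acg H e e0; pose K' := `|K| + 1.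
have K0 : 0 < K' by rewrite /K'; have := normr_ge0 K; lra.
have e20 : 0 < e / (2 * K') by rewrite divr_gt0// mulr_gt0.
have [d1 d10 H1] := acf _ e20; have [d2 d20 H2] := acg _ e20.
exists (Num.min d1 d2); first by rewrite lt_min d10.
move=> N u v uv uv' ; rewrite lt_min => /andP[/(H1 _ _ _ uv uv') {}H1 /(H2 _ _ _ uv uv') {}H2].
apply: (@le_lt_trans _ _ (K' * (\sum_(k < N) `|f (v k) - f (u k)| + \sum_(k < N) `|g (v k) - g (u k)|))).
  rewrite -big_split /= mulr_sumr; apply: ler_sum => k _.
  have [au [uvk vb]] := uv k (ltn_ord k).
  apply: (le_trans (H _ _ au uvk vb)); apply: ler_wpM2r; first by rewrite addr_ge0.
  by apply: (le_trans (ler_norm K)); rewrite lerDl.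
rewrite mulrC -ltr_pdivlMr//.
have -> : e / K' = e / (2 * K') + e / (2 * K') by field; rewrite gt_eqF.
exact: ltrD.
Qed.

Lemma ac_on_dom (R : realType) (a b K : R) (f phi : R -> R) : ac_on a b f ->
  (forall u v, a <= u -> u <= v -> v <= b -> `|phi v - phi u| <= K * `|f v - f u|) ->
  ac_on a b phi.
Proof.
move=> acf H; apply: (ac_on_dom2 _ _ _ `|K| f f) => // u v au uv vb.
apply: (le_trans (H u v au uv vb)).
have := normr_ge0 (f v - f u) => n0.
apply: (@le_trans _ _ (`|K| * `|f v - f u|)); first by rewrite ler_wpM2r// ler_norm.
by rewrite ler_wpM2l// lerDl.
Qed.

Lemma ac_on_id (R : realType) (a b : R) : ac_on a b id.
Proof.
move=> e e0; exists e => // N u v uv _; apply: le_lt_trans.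
by apply: ler_sum => k _; have [_ [? _]] := uv k (ltn_ord k); rewrite ger0_norm// subr_ge0.
Qed.

Lemma ac_on_cst (R : realType) (a b c : R) : ac_on a b (fun=> c).
Proof.
apply: (ac_on_dom _ _ _ 0 id); first exact: ac_on_id.
by move=> u v _ _ _; rewrite subrr normr0 mul0r.
Qed.

Lemma ac_onD (R : realType) (a b : R) (f g : R -> R) :
  ac_on a b f -> ac_on a b g -> ac_on a b (fun s => f s + g s).
Proof.
move=> acf acg; apply: (ac_on_dom2 _ _ _ 1 f g) => // u v _ _ _.
by rewrite mul1r opprD addrACA ler_normD.
Qed.

Lemma ac_onZ (R : realType) (a b c : R) (f : R -> R) :
  ac_on a b f -> ac_on a b (fun s => c * f s).
Proof.
move=> acf; apply: (ac_on_dom _ _ _ `|c| f) => // u v _ _ _.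
by rewrite -mulrBr normrM.
Qed.

Lemma ac_on_sum (R : realType) (a b : R) (I : Type) (r : seq I) (f : I -> R -> R) :
  (forall i, ac_on a b (f i)) -> ac_on a b (fun s => \sum_(i <- r) f i s).
Proof.
move=> H; elim: r => [|i r IH].
  rewrite (_ : (fun s => _) = (fun=> 0)); first exact: ac_on_cst.
  by apply/funext => s; rewrite big_nil.
rewrite (_ : (fun s => _) = (fun s => f i s + \sum_(j <- r) f j s)).
  exact: ac_onD.
by apply/funext => s; rewrite big_cons.
Qed.

Lemma ac_on_bounded (R : realType) (a b : R) (f : R -> R) : ac_on a b f ->
  exists2 K, 0 <= K & forall t, a <= t -> t <= b -> `|f t| <= K.
Proof.
move=> acf.
have [ab|ba] := leP a b; last first.
  by exists 0 => // t at_ tb; move: (le_lt_trans (le_trans at_ tb) ba); rewrite ltxx.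
have [K HK] : exists K, forall t, a <= t -> t <= b -> `|f t| <= K.
  apply: (@cousin _ (fun u v => exists K, forall t, u <= t -> t <= v -> `|f t| <= K)) => //.
  - move=> u v w _ _ _ _ [M1 H1] [M2 H2]; exists (Num.max M1 M2) => x ux xw.
    rewrite le_max; have [xv|vx] := leP x v; first by rewrite H1.
    by rewrite H2 ?orbT// ltW.
  - move=> t /andP[at_ tb]; have [d d0 H] := acf 1 ltr01.
    have key u v : a <= u -> u <= v -> v <= b -> v - u < d -> `|f v - f u| < 1.
      move=> au uv vb vud.
      have := H 1%N (fun=> u) (fun=> v); rewrite !big_ord1; apply => //.
    exists d => // u v au ut tv vb ud vd; exists (`|f t| + 1) => s us sv.
    have [st|ts] := leP s t.
      have := key s t (le_trans au us) st tb ltac:(lra).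
      rewrite distrC; have := ler_normD (f s - f t) (f t); rewrite subrK; lra.
    have := key t s at_ (ltW ts) (le_trans sv vb) ltac:(lra).
    have := ler_normD (f s - f t) (f t); rewrite subrK; lra.
exists `|K| => // t at_ tb; exact: le_trans (HK t at_ tb) (ler_norm _).
Qed.

Lemma ac_onM (R : realType) (a b : R) (f g : R -> R) :
  ac_on a b f -> ac_on a b g -> ac_on a b (fun s => f s * g s).
Proof.
move=> acf acg.
have [K K0 HK] := ac_on_bounded _ _ _ _ acf; have [M M0 HM] := ac_on_bounded _ _ _ _ acg.
apply: (ac_on_dom2 _ _ _ (K + M) f g) => // u v au uv vb.
have -> : f v * g v - f u * g u = f v * (g v - g u) + g u * (f v - f u) by ring.
apply: (le_trans (ler_normD _ _)); rewrite !normrM.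
have := HK v (le_trans au uv) vb; have := HM u au (le_trans uv vb) => gM fK.
have n1 := normr_ge0 (f v - f u); have n2 := normr_ge0 (g v - g u).
have : `|f v| * `|g v - g u| <= K * `|g v - g u| by rewrite ler_wpM2r.
have : `|g u| * `|f v - f u| <= M * `|f v - f u| by rewrite ler_wpM2r.
have := mulr_ge0 K0 n1; have := mulr_ge0 M0 n2.
rewrite mulrDl !mulrDr; lra.
Qed.

Lemma comp_le_vnorm (R : realType) (n : nat) (v : 'cV[R]_n) i : `|v i 0| <= vnorm v.
Proof.
rewrite -sqrtr_sqr ler_wsqrtr// (bigD1 i)//= lerDl sumr_ge0// => j _; exact: sqr_ge0.
Qed.

Lemma vnorm_ge0 (R : realType) (n : nat) (v : 'cV[R]_n) : 0 <= vnorm v.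
Proof. exact: sqrtr_ge0. Qed.

Lemma vnorm_sqr (R : realType) (n : nat) (v : 'cV[R]_n) :
  vnorm v ^+ 2 = \sum_i (v i 0) ^+ 2.
Proof. by rewrite sqr_sqrtr// sumr_ge0// => i _; exact: sqr_ge0. Qed.

Lemma vnorm_le_sum (R : realType) (n : nat) (v : 'cV[R]_n) : vnorm v <= \sum_i `|v i 0|.
Proof.
have s0 : 0 <= \sum_i `|v i 0| by apply: sumr_ge0.
rewrite -(@ler_pXn2r _ 2)// ?nnegrE ?vnorm_ge0// vnorm_sqr expr2 mulr_suml.
apply: ler_sum => i _; rewrite -real_normK ?num_real// expr2 ler_wpM2l//.
by rewrite (bigD1 i)//= lerDl sumr_ge0.
Qed.

Lemma ac_on_comp (R : realType) (n : nat) (a b : R) (x : R -> 'cV[R]_n) i :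
  abs_cont_on a b x -> ac_on a b (fun s => x s i 0).
Proof.
move=> acx e e0; have [d d0 H] := acx _ e0; exists d => // N u v uv uv' s.
apply: le_lt_trans (H N u v uv uv' s); apply: ler_sum => k _.
by have := comp_le_vnorm _ _ (x (v k) - x (u k)) i; rewrite !mxE.
Qed.

Lemma abs_cont_on_comp (R : realType) (n : nat) (a b : R) (x : R -> 'cV[R]_n) :
  (forall i, ac_on a b (fun s => x s i 0)) -> abs_cont_on a b x.
Proof.
move=> H e e0.
(* With [n.+1] the [n] coordinate errors add up to strictly less than [e], also in dimension 0. *)
have e'0 : 0 < e / n.+1%:R by rewrite divr_gt0.
have /choice[d Hd] i : exists d, 0 < d /\ forall (N : nat) (u v : nat -> R),
      (forall k, (k < N)%N -> a <= u k /\ u k <= v k /\ v k <= b) ->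
      (forall k, (k.+1 < N)%N -> v k <= u k.+1) ->
      \sum_(k < N) (v k - u k) < d ->
      \sum_(k < N) `|x (v k) i 0 - x (u k) i 0| < e / n.+1%:R.
  by have [d d0 Hd] := H i _ e'0; exists d; split.
exists (\big[Num.min/1]_i d i).
  elim/big_ind: _ => // [y z y0 z0|i _]; first by rewrite lt_min y0.
  by have [] := Hd i.
move=> N u v uv uv' s.
apply: (@le_lt_trans _ _ (\sum_(i < n) (e / n.+1%:R))); last first.
  rewrite sumr_const card_ord -[X in X < _]mulr_natr.
  have {2}-> : e = e / n.+1%:R * n.+1%:R by rewrite mulfVK// pnatr_eq0.
  by rewrite ltr_pM2l// ltr_nat.
apply: (@le_trans _ _ (\sum_(k < N) \sum_i `|x (v k) i 0 - x (u k) i 0|)).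
  apply: ler_sum => k _; apply: (le_trans (vnorm_le_sum _ _ _)).
  by apply: ler_sum => i _; rewrite !mxE.
rewrite exchange_big /=; apply: ler_sum => i _; apply: ltW.
have [_] := Hd i; apply => //; apply: (lt_le_trans s).
by rewrite (bigD1 i)//= ge_min lexx.
Qed.

(** * The matrix inequality *)

Lemma mx11_tr (R : realType) (N : 'M[R]_1) : N^T 0 0 = N 0 0.
Proof. by rewrite mxE. Qed.

Lemma diag_form (R : realType) (p : nat) (d : 'rV[R]_p) (w v : 'cV[R]_p) :
  (w^T *m diag_mx d *m v) 0 0 = \sum_i d 0 i * w i 0 * v i 0.
Proof.
rewrite -mulmxA mxE; apply: eq_bigr => i _.
by rewrite mul_diag_mx !mxE mulrCA mulrA.
Qed.

Lemma dot_sum (R : realType) (n : nat) (x y : 'cV[R]_n) :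
  (x^T *m y) 0 0 = \sum_i x i 0 * y i 0.
Proof. by rewrite mxE; apply: eq_bigr => i _; rewrite mxE. Qed.

(** The form of the matrix inequality is evaluated at [(x, - w)], the sign being that of the
    feedback u = - w. The terms with [P] and [diag_mx g] form the derivative of V along
    [A *m x - B *m w]; those with [C] alone and with [z] form the sector term on the right. *)
Lemma lmi_decay (R : realType) (n p : nat) (A : 'M[R]_n) (B : 'M[R]_(n, p))
    (C : 'M[R]_(p, n)) (g z : 'rV[R]_p) (P : 'M[R]_n) (eta : R)
    (x : 'cV[R]_n) (w : 'cV[R]_p) :
  P^T = P ->
  neg_semidef (block_mx
       (P *m A + A^T *m P + eta%:M) (P *m B - (C + diag_mx g *m C *m A)^T)
       (B^T *m P - (C + diag_mx g *m C *m A))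
       (- (2%:R *: diag_mx z) - diag_mx g *m C *m B - (diag_mx g *m C *m B)^T)) ->
  2 * (x^T *m P *m (A *m x - B *m w)) 0 0
    + 2 * \sum_i g 0 i * w i 0 * (C *m (A *m x - B *m w)) i 0
    <= - eta * \sum_i (x i 0) ^+ 2
       - 2 * \sum_i w i 0 * ((C *m x) i 0 - z 0 i * w i 0).
Proof.
move=> Psym /(_ (col_mx x (- w))).
set G := diag_mx g; set Z := diag_mx z.
rewrite tr_col_mx mul_row_block mul_row_col.
have fD (N M : 'M[R]_1) : (N + M) 0 0 = N 0 0 + M 0 0 by rewrite mxE.
have fN (N : 'M[R]_1) : (- N) 0 0 = - N 0 0 by rewrite mxE.
have fZ a (N : 'M[R]_1) : (a *: N) 0 0 = a * N 0 0 by rewrite mxE.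
(* A 1 by 1 matrix equals its transpose, which identifies the mirrored terms of the form. *)
have E1 : (x^T *m A^T *m P *m x) 0 0 = (x^T *m P *m A *m x) 0 0.
  by rewrite -mx11_tr !trmx_mul !trmxK Psym !mulmxA.
have E2 : (w^T *m B^T *m P *m x) 0 0 = (x^T *m P *m B *m w) 0 0.
  by rewrite -mx11_tr !trmx_mul !trmxK Psym !mulmxA.
have E3 : (x^T *m C^T *m w) 0 0 = (w^T *m C *m x) 0 0.
  by rewrite -mx11_tr !trmx_mul !trmxK !mulmxA.
have E4 : (x^T *m (A^T *m (C^T *m G^T)) *m w) 0 0 = (w^T *m G *m C *m A *m x) 0 0.
  by rewrite -mx11_tr !trmx_mul !trmxK !mulmxA.
have E5 : (w^T *m (B^T *m (C^T *m G^T)) *m w) 0 0 = (w^T *m G *m C *m B *m w) 0 0.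
  by rewrite -mx11_tr !trmx_mul !trmxK !mulmxA.
have E6 : (x^T *m x) 0 0 = \sum_i (x i 0) ^+ 2.
  by rewrite dot_sum; apply: eq_bigr => i _; rewrite expr2.
have -> : \sum_i g 0 i * w i 0 * (C *m (A *m x - B *m w)) i 0
    = (w^T *m G *m C *m A *m x) 0 0 - (w^T *m G *m C *m B *m w) 0 0.
  rewrite -diag_form -fN -fD -/G; congr (_ 0 0).
  by rewrite !mulmxBr !mulmxA.
have -> : \sum_i w i 0 * ((C *m x) i 0 - z 0 i * w i 0)
    = (w^T *m C *m x) 0 0 - (w^T *m Z *m w) 0 0.
  rewrite diag_form -mulmxA dot_sum -sumrB; apply: eq_bigr => i _.
  by rewrite mulrBr; congr (_ - _); rewrite mulrCA mulrA.
have -> : (x^T *m P *m (A *m x - B *m w)) 0 0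
    = (x^T *m P *m A *m x) 0 0 - (x^T *m P *m B *m w) 0 0.
  by rewrite mulmxBr !mulmxA fD fN.
rewrite -E6.
have -> : (C + G *m C *m A)^T = C^T + A^T *m (C^T *m G^T).
  by rewrite [LHS]linearD /= !trmx_mul.
have -> : (- w)^T = - w^T by rewrite linearN.
have -> : (G *m C *m B)^T = B^T *m (C^T *m G^T) by rewrite !trmx_mul.
rewrite !(mulmxDl, mulmxDr, mulmxN, mulNmx, opprK, opprD).
rewrite -!scalemxAr -!scalemxAl !mul_mx_scalar -!scalemxAl !mulmxA.
(* Reassociating to the right and back to the left brings goal and equations to the same normal
   form. *)
rewrite -!mulmxA in E4 E5 *; rewrite !mulmxA in E4 E5 *.
rewrite !(fD, fN, fZ).
rewrite E1 E2 E3 E4 E5; lra.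
Qed.

(* Cauchy-Schwarz for P applied to x and P^-1 e_i bounds the i-th coordinate of x. *)
Lemma pos_def_coercive (R : realType) (n : nat) (P : 'M[R]_n) : P^T = P -> pos_def P ->
  exists2 l, 0 < l & forall x : 'cV[R]_n, l * \sum_i (x i 0) ^+ 2 <= (x^T *m P *m x) 0 0.
Proof.
move=> Psym Ppos.
have P0 (x : 'cV[R]_n) : 0 <= (x^T *m P *m x) 0 0.
  have [->|x0] := eqVneq x 0; first by rewrite mulmx0 mxE.
  exact/ltW/Ppos.
have Punit : P \in unitmx.
  rewrite -row_free_unit -kermx_eq0; apply/eqP/row_matrixP => i.
  rewrite row0; apply/eqP/negPn/negP => k0.
  have := Ppos (row i (kermx P))^T; rewrite trmxK.
  rewrite -row_mul mulmx_ker row0 mul0mx mxE ltxx => H.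
  by have := H; rewrite -(inj_eq trmx_inj) trmxK trmx0 k0 => /(_ isT).
have CS (u v : 'cV[R]_n) : ((u^T *m P *m v) 0 0) ^+ 2 <= (u^T *m P *m u) 0 0 * (v^T *m P *m v) 0 0.
  set a := (u^T *m P *m u) 0 0; set b := (u^T *m P *m v) 0 0; set c := (v^T *m P *m v) 0 0.
  have ba : (v^T *m P *m u) 0 0 = b by rewrite -mx11_tr !trmx_mul trmxK Psym mulmxA.
  have q s t : 0 <= s ^+ 2 * a + 2 * s * t * b + t ^+ 2 * c.
    have := P0 (s *: u + t *: v); congr (_ <= _).
    have -> : (s *: u + t *: v)^T = s *: u^T + t *: v^T.
      by rewrite [LHS]linearD /= !linearZ.
    rewrite !(mulmxDl, mulmxDr) -!scalemxAl -!scalemxAr.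
    have fD (N M : 'M[R]_1) : (N + M) 0 0 = N 0 0 + M 0 0 by rewrite mxE.
    have fZ k (N : 'M[R]_1) : (k *: N) 0 0 = k * N 0 0 by rewrite mxE.
    rewrite !(fD, fZ) -/a -/b -/c ba; ring.
  have a0 : 0 <= a := P0 u; have c0 : 0 <= c := P0 v.
  have [a1|a1] := eqVneq a 0.
    (* For [a = 0] the form is affine in [s]: the choice [s = - (c + 1)], [t = b] yields
       [b ^+ 2 * (c + 2) <= 0]. *)
    have := q ((- b) * (c + 1)) (b ^+ 2); have := q (- (c + 1)) b.
    rewrite a1 mul0r mulr0 add0r => H _.
    have : b ^+ 2 * (2 * (c + 1) - c) <= 0 by lra.
    by rewrite pmulr_lle0//; lra.
  have ap : 0 < a by rewrite lt_def a1.
  have := q (- b) a; rewrite -subr_ge0 => H.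
  rewrite -subr_ge0 -(pmulr_rge0 _ ap); apply: le_trans H _; lra.
pose u i : 'cV[R]_n := invmx P *m delta_mx i 0.
have xi (x : 'cV[R]_n) i : x i 0 = ((u i)^T *m P *m x) 0 0.
  by rewrite /u trmx_mul trmx_inv Psym trmx_delta -[_ *m P]mulmxA mulVmx// mulmx1 -rowE mxE.
(* The sum is the trace of the inverse of [P]; the added 1 keeps [S] positive in dimension 0 as
   well. *)
pose S := 1 + \sum_i ((u i)^T *m P *m u i) 0 0.
have S0 : 0 < S by rewrite ltr_pwDl// sumr_ge0.
exists S^-1; rewrite ?invr_gt0// => x.
rewrite mulrC ler_pdivrMr// mulrC /S mulrDl mul1r.
apply: (@le_trans _ _ (\sum_i ((u i)^T *m P *m u i) 0 0 * (x^T *m P *m x) 0 0)).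
  by apply: ler_sum => i _; rewrite xi; exact: CS.
by rewrite -mulr_suml lerDr.
Qed.

(** * Decay of the Lyapunov function *)

Lemma qform_sum (R : realType) (n : nat) (P : 'M[R]_n) (x : 'cV[R]_n) :
  (x^T *m P *m x) 0 0 = \sum_i x i 0 * (P *m x) i 0.
Proof. by rewrite -mulmxA dot_sum. Qed.

Lemma has_der_mulmx (R : realType) (m n : nat) (M : 'M[R]_(m, n)) (x : R -> 'cV[R]_n)
    (v : 'cV[R]_n) (t : R) j :
  (forall i, has_der (fun s => x s i 0) t (v i 0)) ->
  has_der (fun s => (M *m x s) j 0) t ((M *m v) j 0).
Proof.
move=> H; rewrite mxE (_ : (fun s => _) = (fun s => \sum_k M j k * x s k 0)).
  by apply: has_der_sum => k; exact: has_derZ.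
by apply/funext => s; rewrite mxE.
Qed.

Lemma ac_on_mulmx (R : realType) (m n : nat) (M : 'M[R]_(m, n)) (x : R -> 'cV[R]_n) a b j :
  (forall i, ac_on a b (fun s => x s i 0)) -> ac_on a b (fun s => (M *m x s) j 0).
Proof.
move=> H; rewrite (_ : (fun s => _) = (fun s => \sum_k M j k * x s k 0)).
  by apply: ac_on_sum => k; exact: ac_onZ.
by apply/funext => s; rewrite mxE.
Qed.

Lemma sector_sign (R : realType) (f : R -> R) (z : \bar R) :
  (0 < z)%E -> sector_cond f z -> forall s, 0 <= f s * s.
Proof.
case: z => [r| |] //=; rewrite lte_fin => r0 sc s.
have := sc s; rewrite mulrBr subr_le0 mulrCA => H.
rewrite -(pmulr_rge0 _ r0); apply: le_trans H; rewrite -expr2; exact: sqr_ge0.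
Qed.

Lemma prim_ac (R : realType) (f : R -> R) (y : R -> R) (a b : R) :
  piecewise_continuous f -> ac_on a b y -> ac_on a b (fun s => prim f (y s)).
Proof.
move=> pcf acy; have [K K0 HK] := ac_on_bounded _ _ _ _ acy.
have [M M0 HM] := prim_lip _ _ pcf K.
apply: (ac_on_dom _ _ _ M y) => // u v au uv vb.
by apply: HM; apply: HK => //; [exact: le_trans uv vb|exact: le_trans au uv].
Qed.

(** Almost everywhere the derivative is [f t], which has the sign of [t] or vanishes;
    [ac_nonincreasing] applies to [prim f] on the left of 0 and to its opposite on the right. *)
Lemma prim_monotone (R : realType) (f : R -> R) : piecewise_continuous f ->
  (forall s, 0 <= f s * s) ->
  (forall u v, 0 <= u -> u <= v -> prim f u <= prim f v) /\
  (forall u v, u <= v -> v <= 0 -> prim f v <= prim f u).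
Proof.
move=> pcf sgn.
have ae0 : {ae (@lebesgue_measure R), forall t, t != 0 /\ has_der (prim f) t (f t)}.
  have [U oU [cU fU]] := pc_countable_disc _ _ pcf.
  have c0 : countable [set (0 : R)] by apply: finite_set_countable; exact: finite_set1.
  have := ae_and _ _ _ (ae_countable _ _ cU) (ae_countable _ _ c0).
  apply: ae_mono => t [/contrapT Ut /eqP t0]; split => //.
  by apply: prim_der => //; exact: fU.
have acp u v : ac_on u v (prim f) by apply: prim_ac => //; exact: ac_on_id.
split.
- move=> u v u0 uv.
  have := @ac_nonincreasing R (fun s => - 1 * prim f s) u v uv (ac_onZ _ _ _ _ _ (acp u v)).
  rewrite !mulN1r lerN2; apply.
  apply: ae_mono ae0 => t [t0 ft] /andP[ut tv].
  have /has_derP[? ->] := has_derZ _ _ (- 1) _ _ ft; split => //.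
  rewrite mulN1r oppr_le0; have tp : 0 < t by rewrite lt_def t0 (le_trans u0).
  by have := sgn t; rewrite pmulr_lge0.
- move=> u v uv v0; apply: ac_nonincreasing => //.
  apply: ae_mono ae0 => t [t0 ft] /andP[ut tv].
  have /has_derP[? ->] := ft; split => //.
  have tp : t < 0 by rewrite lt_def eq_sym t0 (le_trans tv).
  by have := sgn t; rewrite nmulr_lge0.
Qed.

Lemma prim_ge0 (R : realType) (f : R -> R) : piecewise_continuous f ->
  (forall s, 0 <= f s * s) -> forall y, 0 <= prim f y.
Proof.
move=> pcf sgn y; have [H1 H2] := prim_monotone _ _ pcf sgn.
rewrite -(prim0 _ f); have [y0|y0] := leP 0 y; first exact: H1.
by apply: H2 => //; exact: ltW.
Qed.

Lemma mem_itv_between (R : realType) (I : interval R) (s t r : R) :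
  s \in I -> t \in I -> s <= r -> r <= t -> r \in I.
Proof.
case: I => a b; rewrite !itv_boundlr => /andP[as_ _] /andP[_ tb] sr rt.
by rewrite (le_trans as_)//= (le_trans _ tb).
Qed.

Definition lyapunov {R : realType} {n p : nat} (C : 'M[R]_(p, n)) (psi : 'I_p -> R -> R)
    (g : 'rV[R]_p) (P : 'M[R]_n) (x : 'cV[R]_n) : R :=
  (x^T *m P *m x) 0 0 + \sum_i 2 * (g 0 i * prim (psi i) ((C *m x) i 0)).

Lemma lyapunov_ac (R : realType) (n p : nat) (C : 'M[R]_(p, n)) (psi : 'I_p -> R -> R)
    (g : 'rV[R]_p) (P : 'M[R]_n) (x : R -> 'cV[R]_n) (a b : R) :
  (forall i, piecewise_continuous (psi i)) -> abs_cont_on a b x ->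
  ac_on a b (fun s => lyapunov C psi g P (x s)).
Proof.
move=> pcf acx; have aci i := ac_on_comp _ _ _ _ _ i acx.
apply: ac_onD.
  rewrite (_ : (fun s => _) = (fun s => \sum_i x s i 0 * (P *m x s) i 0)); last first.
    by apply/funext => s; rewrite qform_sum.
  by apply: ac_on_sum => i; apply: ac_onM => //; exact: ac_on_mulmx.
apply: ac_on_sum => i; do 2 apply: ac_onZ; apply: prim_ac => //.
exact: ac_on_mulmx.
Qed.

Lemma lyapunov_der (R : realType) (n p : nat) (C : 'M[R]_(p, n)) (psi : 'I_p -> R -> R)
    (g : 'rV[R]_p) (P : 'M[R]_n) (x : R -> 'cV[R]_n) (t : R) (v : 'cV[R]_n) (w : 'cV[R]_p) :
  P^T = P ->
  (forall i, has_der (fun s => x s i 0) t (v i 0)) ->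
  (forall i, has_der (prim (psi i) \o (fun s => (C *m x s) i 0)) t (w i 0 * (C *m v) i 0)) ->
  has_der (fun s => lyapunov C psi g P (x s)) t
    (2 * ((x t)^T *m P *m v) 0 0 + 2 * \sum_i g 0 i * w i 0 * (C *m v) i 0).
Proof.
move=> Psym xv pw; apply: has_derD.
  rewrite (_ : (fun s => _) = (fun s => \sum_i x s i 0 * (P *m x s) i 0)); last first.
    by apply/funext => s; rewrite qform_sum.
  have -> : 2 * ((x t)^T *m P *m v) 0 0 =
      \sum_i (x t i 0 * (P *m v) i 0 + (P *m x t) i 0 * v i 0).
    rewrite big_split /= -dot_sum -dot_sum trmx_mul Psym !mulmxA; ring.
  by apply: has_der_sum => i; apply: has_derM => //; exact: has_der_mulmx.
rewrite mulr_sumr; apply: has_der_sum => i; apply: has_derZ.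
by rewrite -mulrA; apply: has_derZ; exact: pw.
Qed.

(** A constant lower bound [q] of |x|^2 replaces the integral of |x|^2: V + [eta * q * r] has
    nonpositive derivative almost everywhere. The value [q = 0] gives monotonicity of V, a positive
    [q] the rate. *)
Lemma lyapunov_decay (R : realType) (n p : nat) (A : 'M[R]_n) (B : 'M[R]_(n, p))
    (C : 'M[R]_(p, n)) (psi : 'I_p -> R -> R) (zeta : 'I_p -> \bar R)
    (g : 'rV[R]_p) (P : 'M[R]_n) (eta : R) (I : interval R) (x : R -> 'cV[R]_n) :
  assumption1 psi zeta -> P^T = P -> 0 <= eta ->
  neg_semidef (block_mx
       (P *m A + A^T *m P + eta%:M) (P *m B - (C + diag_mx g *m C *m A)^T)
       (B^T *m P - (C + diag_mx g *m C *m A))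
       (- (2%:R *: diag_mx (\row_i zinv (zeta i))) - diag_mx g *m C *m B - (diag_mx g *m C *m B)^T)) ->
  is_solution (Fk A B C psi) I x ->
  forall s t q, s \in I -> t \in I -> s <= t ->
    (forall r, s <= r -> r <= t -> q <= \sum_i (x r i 0) ^+ 2) ->
    lyapunov C psi g P (x t) + eta * q * (t - s) <= lyapunov C psi g P (x s).
Proof.
move=> A1 Psym eta0 lmi [_ [acI aeI]] s t q sI tI st Hq.
have pcf i : piecewise_continuous (psi i) by have [] := A1 i.
have acx := acI s t sI tI.
have acy i : ac_on s t (fun r => (C *m x r) i 0).
  by apply: ac_on_mulmx => j; exact: ac_on_comp.
have aechain i : {ae (@lebesgue_measure R), forall r, s <= r <= t -> forall D w,
    has_der (fun r => (C *m x r) i 0) r D -> krasovskii (psi i) ((C *m x r) i 0) w ->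
    has_der (prim (psi i) \o (fun r => (C *m x r) i 0)) r (w * D)}.
  have [K K0 HK] := ac_on_bounded _ _ _ _ (acy i).
  have := chain_ae R (psi i) (fun r => (C *m x r) i 0) K (pcf i).
  by apply: ae_mono => r H /andP[sr rt]; apply: H; exact: HK.
have := @ac_nonincreasing R (fun r => lyapunov C psi g P (x r) + eta * q * r) s t st.
have acV : ac_on s t (fun r => lyapunov C psi g P (x r) + eta * q * r).
  by apply: ac_onD; [exact: lyapunov_ac|apply: ac_onZ; exact: ac_on_id].
move=> /(_ acV); suff: {ae (@lebesgue_measure R), forall r, s <= r <= t ->
     derivable (fun r => lyapunov C psi g P (x r) + eta * q * r) r 1 /\
     derive1 (fun r => lyapunov C psi g P (x r) + eta * q * r) r <= 0}.
  by move=> ae0 /(_ ae0); lra.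
have := ae_and _ _ _ aeI (ae_ord _ _ _ aechain).
apply: ae_mono => r [Hr Hc] srt; have /andP[sr rt] := srt.
have rI : r \in I by exact: mem_itv_between sr rt.
have [dx [w [kw dE]]] := Hr rI.
have xv i : has_der (fun s => x s i 0) r ((vderiv x r) i 0).
  by apply/has_derP; rewrite /vderiv mxE; split => //; exact: dx.
have dV := lyapunov_der R n p C psi g P x r _ w Psym xv
  (fun i => Hc i srt _ _ (has_der_mulmx _ _ _ C x _ r i xv) (kw i)).
have dq : has_der (fun r : R => eta * q * r) r (eta * q * 1).
  apply: has_derZ; move=> e e0; exists 1 => // u _.
  by rewrite mul1r subrr normr0 mulr_ge0// ltW.
have /has_derP[dd ->] := has_derD _ _ _ _ _ _ dV dq; split => //.
rewrite dE mulr1.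
have := lmi_decay R n p A B C g (\row_i zinv (zeta i)) P eta (x r) w Psym lmi.
have sec : 0 <= \sum_i w i 0 * ((C *m x r) i 0 - (\row_i zinv (zeta i)) 0 i * w i 0).
  apply: sumr_ge0 => i _; rewrite mxE; have [_ [z0 sc]] := A1 i.
  exact: krasovskii_sector z0 sc (kw i).
have : eta * q <= eta * \sum_i (x r i 0) ^+ 2 by rewrite ler_wpM2l// Hq.
lra.
Qed.

(** * Lipschitz functions are differentiable almost everywhere *)

Lemma lsm_itvoc (R : realType) (f : cumulative R R) (a b : R) : a <= b ->
  lebesgue_stieltjes_measure f `]a, b]%classic = (f b - f a)%:E.
Proof.
move=> ab.
rewrite /lebesgue_stieltjes_measure /measure_extension measurable_mu_extE/=; last exact: is_ocitv.
by rewrite wlength_itv_bnd.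
Qed.

Lemma continuous_nd_cumulative (R : realType) (f : R -> R) :
  {homo f : x y / x <= y} -> continuous f ->
  exists g : cumulative R R, forall x, g x = f x.
Proof.
move=> ndf cf.
pose m := isCumulative.Build R _ R f ndf (right_continuousW cf).
pose g : cumulative R R := HB.pack f m.
by exists g.
Qed.

(* The Stieltjes measures of g and k add up to L times the Lebesgue measure. *)
Lemma lsm_lipschitz_dominates (R : realType) (L : R) (g k : cumulative R R) :
  0 <= L -> (forall t, g t + k t = L * t) ->
  forall A : set (measurableTypeR R), measurable A ->
    (@lebesgue_measure R A = 0)%E -> lebesgue_stieltjes_measure g A = 0%E.
Proof.
move=> L0 gk A mA A0.
pose Lpos := NngNum L0.
have eqm (X : set (measurableTypeR R)) : measurable X ->
    measure_add (lebesgue_stieltjes_measure g) (lebesgue_stieltjes_measure k) X =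
    mscale Lpos (@lebesgue_measure R) X.
  move=> mX.
  (* Half-open intervals are stable under intersection and exhaust the line by sets of finite
     measure, so agreement on them is enough. *)
  apply: (@measure_unique _ R (measurableTypeR R) (@ocitv R) (fun n => `](- n%:R), n%:R]%classic)) => //.
  - exact: ocitvI.
  - move=> i; exact: is_ocitv.
  - apply/seteqP; split => // x _.
    exists (Num.truncn `|x|).+1 => //=; rewrite in_itv /=.
    have := truncnS_gt `|x|; rewrite ltr_norml => /andP[-> /ltW ->] //.
  - move=> B /ocitvP[->|[[a b] /= ab ->]]; first by rewrite !measure0.
    rewrite [LHS](measure_addE _ _ _) /mscale /= !lsm_itvoc ?ltW//.
    rewrite lebesgue_measure_itv /= lte_fin ab -EFinD -EFinM; congr EFin.
    rewrite addrACA -opprD !gk; ring.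
  - move=> n.
    have nn : - n%:R <= n%:R :> R by rewrite ge0_cp.
    apply: (@le_lt_trans _ _ ((g n%:R - g (- n%:R))%:E + (k n%:R - k (- n%:R))%:E)%E);
      last by rewrite -EFinD ltry.
    rewrite -(lsm_itvoc _ g _ _ nn) -(lsm_itvoc _ k _ _ nn).
    by rewrite le_eqVlt; apply/orP; left; apply/eqP; exact: measure_addE.
have := eqm A mA.
rewrite measure_addE /mscale /= [lebesgue_measure _]A0 mule0 => H.
apply/eqP; rewrite eq_le measure_ge0 andbT -H leeDl//.
Qed.

(** Adding [L * t] makes [f] nondecreasing, and the resulting Stieltjes measure is dominated by
    Lebesgue measure. Its Radon-Nikodym density is, up to the slope [L], the derivative at every
    Lebesgue point. Restricting to []-N, N]] makes the measure finite. *)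
Lemma lipschitz_ae_derivable_loc (R : realType) (f : R -> R) (L N : R) : 0 <= L ->
  (forall s t, `|f s - f t| <= L * `|s - t|) -> 0 < N ->
  {ae (@lebesgue_measure R), forall t, - N < t < N -> derivable f t 1}.
Proof.
move=> L0 fL N0.
have cf : continuous f.
  move=> t; apply/cvgrPdist_lt => e e0; near=> s.
  rewrite (le_lt_trans (fL _ _))//.
  apply: (@le_lt_trans _ _ ((L + 1) * `|t - s|)); first by rewrite ler_wpM2r// lerDl.
  rewrite mulrC -ltr_pdivlMr; last lra.
  near: s; apply: cvgr_dist_lt => //.
  by rewrite divr_gt0//; lra.
have cL : continuous (fun t : R => L * t).
  by move=> t; apply: cvgM; [exact: cvg_cst|exact: cvg_id].
have [|x|g gE] := continuous_nd_cumulative _ (fun t => L * t + f t).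
- move=> x y xy; have := fL x y; rewrite ler_distl distrC ger0_norm ?subr_ge0//.
  rewrite mulrBr; lra.
- by apply: cvgD; [exact: cL|exact: cf].
have [|x|k kE] := continuous_nd_cumulative _ (fun t => L * t - f t).
- move=> x y xy; have := fL x y; rewrite ler_distl distrC ger0_norm ?subr_ge0//.
  rewrite mulrBr; lra.
- by apply: cvgB; [exact: cL|exact: cf].
have dom := lsm_lipschitz_dominates R (2 * L) g k.
pose E : set (measurableTypeR R) := `](- N), N]%classic.
have mE : measurable E by exact: measurable_itv.
have foo : (lebesgue_stieltjes_measure g E < +oo)%E.
  by rewrite lsm_itvoc ?ltry// ge0_cp// ltW.
pose nu := mfrestr mE foo.
have nudom : nu `<< (@lebesgue_measure R).
  apply/null_content_dominatesP => B mB B0.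
  rewrite /nu /mfrestr /mrestr /=.
  apply: dom => //; first by rewrite mulr_ge0.
  - by move=> t; rewrite gE kE; ring.
  - exact: measurableI.
  - by apply: (subset_measure0 _ _ _ B0) => //; exact: measurableI.
have [h [h0 hfin inth nuE]] := radon_nikodym_sigma_finite nudom.
have nuE' B (mB : measurable B) :
  lebesgue_stieltjes_measure g (B `&` E) = _ := nuE B mB.
pose h' := fine \o h.
have hE : EFin \o h' = h by apply/funext => t /=; rewrite fineK.
have inth' : (@lebesgue_measure R).-integrable setT (EFin \o h') by rewrite hE.
have loch : locally_integrable setT h' by apply: open_integrable_locally => //; exact: openT.
have := lebesgue_differentiation loch.
apply: ae_mono => t lt /andP[Nt tN].
have [||dF _] := @FTC1_lebesgue_pt R h' (BRight (- N)) t N tN _ _ lt.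
- apply: (@integrableS _ _ _ _ setT) => //.
- by rewrite lte_fin.
(* The trivial equation supplies the value half of [has_derP], the derivative being named [D]
   afterwards. *)
move/(conj dF)/has_derP : (erefl (derive1 (fun y => (\int[lebesgue_measure]_(u in [set` Interval (BRight (- N)) (BRight y)]) (h' u))%R) t)).
set D := derive1 _ _ => {}dF.
have d0 : 0 < Num.min (N + t) (N - t) by rewrite lt_min; apply/andP; split; lra.
have : has_der (fun s => L * s + f s - g (- N)) t D.
  apply: has_der_congr d0 _ dF => y.
  rewrite lt_min => /andP[/ltr_dist_bounds[? ?] /ltr_dist_bounds[? ?]].
  have Ny : - N < y by lra.
  have yN : y < N by lra.
  rewrite /Rintegral.
  under eq_integral do rewrite fineK//.
  rewrite -nuE'; last exact: measurable_itv.
  rewrite setIidl; last first.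
    by apply: subset_itvl; rewrite bnd_simp ltW.
  by rewrite lsm_itvoc ?ltW//= gE.
move=> dg.
have : has_der f t (D - L).
  move=> e /dg[d dp H]; exists d => // s /H.
  by congr (`|_| <= _); ring.
by move/has_derP => [].
Unshelve. all: by end_near. Qed.

Lemma lipschitz_ae_derivable (R : realType) (f : R -> R) (L : R) : 0 <= L ->
  (forall s t, `|f s - f t| <= L * `|s - t|) ->
  {ae (@lebesgue_measure R), forall t, derivable f t 1}.
Proof.
move=> L0 fL.
have H n := lipschitz_ae_derivable_loc R f L n.+1%:R L0 fL (ltr0Sn _ _).
have := ae_foralln H.
apply: ae_mono => t Ht.
apply: (Ht (Num.truncn `|t|)).
by rewrite -ltr_norml truncnS_gt.
Qed.

(** * Limits of Euler schemes *)

(** Along an ultrafilter every bounded sequence converges, so a single [U] serves all times and all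
    coordinates at once, in place of subsequences chosen by a diagonal argument. *)
Definition ulim {R : realType} (U : set_system nat) (u : nat -> R) (l : R) : Prop :=
  forall e, 0 < e -> U [set k | `|u k - l| < e].

(** Compactness gives a cluster point [l]. If the indices close to [l] were not in [U], their
    complement would be, against clustering. *)
Lemma ulim_exists (R : realType) (U : set_system nat) (u : nat -> R) (M : R) :
  UltraFilter U -> (forall k, `|u k| <= M) -> exists l, ulim U u l.
Proof.
move=> UU uM; have PU : ProperFilter U by exact: ultra_proper.
have UM : U [set k | `[- M, M]%classic (u k)].
  by apply: filterE => k /=; rewrite in_itv /= -ler_norml.
have [l [_ cl]] := @segment_compact R (- M) M (u @ U) _ UM.
exists l => e e0.
have [//|nU] := in_ultra_setVsetC [set k | `|u k - l| < e] UU.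
have UA : U [set k | (u @` ~` [set k | `|u k - l| < e]) (u k)].
  by apply: filterS nU => k nk; exists k.
have [] := cl (u @` ~` [set k | `|u k - l| < e]) (ball l e) UA.
- exact: nbhsx_ballx.
- by move=> _ [[k nk <-]]; rewrite /ball /= distrC => /nk.
Qed.

Lemma ulim_unique (R : realType) (U : set_system nat) (u : nat -> R) (l m : R) :
  ProperFilter U -> ulim U u l -> ulim U u m -> l = m.
Proof.
move=> PU ul um; apply/eqP; rewrite -subr_eq0 -normr_eq0 eq_le normr_ge0 andbT.
apply/ler_addgt0Pr => e e0; rewrite add0r.
have e20 : 0 < e / 2 by rewrite divr_gt0.
have [k [/= k1 k2]] := filter_ex (filterI (ul _ e20) (um _ e20)).
have -> : l - m = (u k - m) - (u k - l) by ring.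
apply: (le_trans (ler_normB _ _)); lra.
Qed.

Lemma ulim_cst (R : realType) (U : set_system nat) (c : R) : Filter U -> ulim U (fun=> c) c.
Proof. by move=> FU e e0; apply: filterE => k /=; rewrite subrr normr0. Qed.

Lemma ulimD (R : realType) (U : set_system nat) (u v : nat -> R) (l m : R) : Filter U ->
  ulim U u l -> ulim U v m -> ulim U (fun k => u k + v k) (l + m).
Proof.
move=> FU ul vm e e0; have e20 : 0 < e / 2 by rewrite divr_gt0.
apply: filterS (filterI (ul _ e20) (vm _ e20)) => k [/= k1 k2].
have -> : u k + v k - (l + m) = (u k - l) + (v k - m) by ring.
apply: (le_lt_trans (ler_normD _ _)); lra.
Qed.

Lemma ulimZ (R : realType) (U : set_system nat) (c : R) (u : nat -> R) (l : R) : Filter U ->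
  ulim U u l -> ulim U (fun k => c * u k) (c * l).
Proof.
move=> FU ul e e0; have c0 : 0 < `|c| + 1 by have := normr_ge0 c; lra.
apply: filterS (ul _ (divr_gt0 e0 c0)) => k /=.
rewrite ltr_pdivlMr// -mulrBr normrM => H.
apply: le_lt_trans H; rewrite mulrC ler_wpM2l// lerDl ler01//.
Qed.

Lemma ulim_sum (R : realType) (U : set_system nat) (I : Type) (r : seq I)
    (u : I -> nat -> R) (l : I -> R) : Filter U ->
  (forall i, ulim U (u i) (l i)) ->
  ulim U (fun k => \sum_(i <- r) u i k) (\sum_(i <- r) l i).
Proof.
move=> FU ul; elim: r => [|i r IH].
  rewrite big_nil (_ : (fun k => _) = (fun=> 0)); first exact: ulim_cst.
  by apply/funext => k; rewrite big_nil.
rewrite big_cons (_ : (fun k => _) = (fun k => u i k + \sum_(j <- r) u j k)).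
  exact: ulimD.
by apply/funext => s; rewrite big_cons.
Qed.

Lemma convexR_avg (R : realType) (C : set R) (b : nat -> R) (m : nat) : convexR C ->
  (forall l, (l < m.+1)%N -> C (b l)) -> C ((\sum_(l < m.+1) b l) / m.+1%:R).
Proof.
move=> cC; elim: m => [|m IH] H; first by rewrite big_ord1 divr1; exact: H.
have m1 : (0 : R) < m.+1%:R by rewrite ltr0n.
have m2 : (0 : R) < m.+2%:R by rewrite ltr0n.
(* The longer average is the shorter one with weight [(m + 1) / (m + 2)], combined with the last
   point. *)
have := cC _ (b m.+1) (m.+1%:R / m.+2%:R) (IH (fun l lm => H l (ltnW lm))) (H _ (ltnSn _)).
rewrite divr_ge0 ?(ltW m1) ?(ltW m2)//= ler_pdivrMr// mul1r ler_nat leqnSn => /(_ isT).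
congr (C _); rewrite [in RHS]big_ord_recr /= [in RHS]mulrDl; congr (_ + _).
  by field; rewrite !gt_eqF.
rewrite mulrC; congr (_ * _); rewrite -{1}(@divff _ m.+2%:R) ?gt_eqF// -mulrBl.
by rewrite -natrB// subSnn mul1r.
Qed.

Definition stepsize {R : realType} (k : nat) : R := k.+1%:R^-1.

Lemma stepsize_gt0 (R : realType) k : 0 < stepsize k :> R.
Proof. by rewrite invr_gt0 ltr0n. Qed.

Lemma stepsize_small (R : realType) (U : set_system nat) (e : R) : Filter U ->
  (\oo : set_system nat) `<=` U -> 0 < e -> U [set k | stepsize k < e].
Proof.
move=> FU sU e0; apply: sU; exists (Num.truncn e^-1) => // k /= ek.
rewrite /stepsize invf_plt ?posrE ?ltr0n//; apply: (lt_le_trans (truncnS_gt _)).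
by rewrite ler_nat.
Qed.

(** [Num.truncn] is 0 on negative numbers: before [T] no step is made, and the limits are defined on
    the whole line. *)
Definition nsteps {R : realType} (T : R) (k : nat) (t : R) : nat :=
  Num.truncn ((t - T) * k.+1%:R).

Lemma nsteps_bounds (R : realType) (T t : R) (k : nat) : T <= t ->
  t - T - stepsize k <= stepsize k * (nsteps T k t)%:R /\
  stepsize k * (nsteps T k t)%:R <= t - T.
Proof.
move=> Tt; have k0 : (0 : R) < k.+1%:R by rewrite ltr0n.
have x0 : 0 <= (t - T) * k.+1%:R by rewrite mulr_ge0 ?subr_ge0 ?(ltW k0).
have := truncn_itv x0; rewrite -/(nsteps T k t) => /andP[lo hi].
rewrite /stepsize; split.
  rewrite -(ler_pM2l k0).
  have -> : k.+1%:R * (t - T - k.+1%:R^-1) = (t - T) * k.+1%:R - 1.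
    by field; rewrite gt_eqF.
  rewrite mulrA mulfV ?gt_eqF// mul1r.
  by rewrite -natr1 in hi; lra.
by rewrite mulrC ler_pdivrMr.
Qed.

Lemma nsteps_homo (R : realType) (T s t : R) (k : nat) : s <= t ->
  (nsteps T k s <= nsteps T k t)%N.
Proof.
by move=> st; apply: le_truncn; rewrite ler_wpM2r ?ler0n// lerD2r.
Qed.

Lemma nsteps_max (R : realType) (T t : R) (k : nat) :
  nsteps T k t = nsteps T k (Num.max t T).
Proof.
have [//|tT] := leP T t; rewrite /nsteps subrr mul0r truncn0.
by apply/eqP; rewrite -leqn0 -(@truncn0 R) le_truncn// mulr_le0_ge0// subr_le0 ltW.
Qed.

(** Accumulated Euler increments, piecewise constant in [t] instead of interpolated; for bounded
    slopes the jumps are of the order of the step and vanish in the limit. *)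
Definition step_sum {R : realType} (T : R) (a : nat -> nat -> R) (k : nat) (t : R) : R :=
  \sum_(l < nsteps T k t) stepsize k * a k l.

Lemma step_sumB (R : realType) (T : R) (a : nat -> nat -> R) (k : nat) (s t : R) : s <= t ->
  step_sum T a k t - step_sum T a k s =
  stepsize k * \sum_(l < nsteps T k t - nsteps T k s) a k (nsteps T k s + l)%N.
Proof.
move=> st; rewrite /step_sum -!mulr_sumr -mulrBr; congr (_ * _).
rewrite -[in LHS](subnKC (nsteps_homo _ T _ _ k st)) big_split_ord /=.
by rewrite addrAC subrr add0r.
Qed.

(** Rounding both times down to the grid costs at most one extra step, hence the summand
    [stepsize k]. *)
Lemma step_sum_bound (R : realType) (T M : R) (a : nat -> nat -> R) (k : nat) (s t : R) :
  (forall l, `|a k l| <= M) -> T <= s -> s <= t ->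
  `|step_sum T a k t - step_sum T a k s| <= M * (t - s + stepsize k).
Proof.
move=> aM Ts st; rewrite step_sumB// normrM (ger0_norm (ltW (stepsize_gt0 _ k))).
have M0 : 0 <= M := le_trans (normr_ge0 _) (aM 0%N).
apply: (@le_trans _ _ (stepsize k * (M * (nsteps T k t - nsteps T k s)%:R))).
  rewrite ler_wpM2l ?(ltW (stepsize_gt0 _ k))//.
  apply: (le_trans (ler_norm_sum _ _ _)).
  apply: (@le_trans _ _ (\sum_(l < nsteps T k t - nsteps T k s) M)).
    by apply: ler_sum.
  by rewrite sumr_const card_ord mulr_natr.
rewrite mulrCA ler_wpM2l// natrB ?nsteps_homo// mulrBr.
have [] := nsteps_bounds _ T s k Ts; have [] := nsteps_bounds _ T t k (le_trans Ts st); lra.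
Qed.

Lemma step_limit (R : realType) (U : set_system nat) (T M : R) (a : nat -> nat -> R) :
  UltraFilter U -> (\oo : set_system nat) `<=` U -> (forall k l, `|a k l| <= M) ->
  exists S : R -> R, [/\ forall t, ulim U (fun k => step_sum T a k t) (S t),
    forall s t, `|S s - S t| <= M * `|s - t| & S T = 0].
Proof.
move=> UU sU aM; have PU : ProperFilter U by exact: ultra_proper.
have M0 : 0 <= M := le_trans (normr_ge0 _) (aM 0%N 0%N).
have sT k : step_sum T a k T = 0.
  by rewrite /step_sum /nsteps subrr mul0r truncn0 big_ord0.
have k1 k : stepsize k <= 1 :> R.
  by rewrite /stepsize invf_le1 ?ltr0n// ler1n.
have /choice[S HS] t : exists l, ulim U (fun k => step_sum T a k t) l.
  apply: (ulim_exists _ _ _ (M * (`|t - T| + 1))) => // k.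
  rewrite /step_sum nsteps_max -/(step_sum T a k _).
  have Tm : T <= Num.max t T by rewrite le_max lexx orbT.
  have := step_sum_bound R T M a k T (Num.max t T) (aM k) (lexx _) Tm.
  rewrite sT subr0 => /le_trans; apply; rewrite ler_wpM2l// lerD//.
  by have [tT|tT] := leP T t; [exact: ler_norm|rewrite subrr].
exists S; split => //; last first.
  apply: (ulim_unique _ U (fun k => step_sum T a k T)) => //.
  by rewrite (_ : (fun k => _) = fun=> 0); [exact: ulim_cst|apply/funext => k].
have key s t : s <= t -> `|S t - S s| <= M * (t - s).
  move=> st; apply/ler_addgt0Pr => e e0.
  (* Two errors come from the limits at [s] and [t], and [M] times one from the extra step. *)
  have c0 : 0 < 2 + M by lra.
  have e'0 : 0 < e / (2 + M) by rewrite divr_gt0.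
  have [k [[/= ks kt] kh]] := filter_ex (filterI (filterI (HS s _ e'0) (HS t _ e'0))
    (stepsize_small _ _ _ _ sU e'0)).
  have D : `|step_sum T a k t - step_sum T a k s| <= M * (t - s + stepsize k).
    rewrite /step_sum (nsteps_max _ T t) (nsteps_max _ T s).
    rewrite -!/(step_sum T a k _).
    have mst : Num.max s T <= Num.max t T by rewrite ge_max !le_max st lexx orbT.
    apply: (le_trans (step_sum_bound R T M a k _ _ (aM k) _ mst)); first by rewrite le_max lexx orbT.
    rewrite ler_wpM2l// lerD2r.
    have [sT'|sT'] := leP T s; have [tT|tT] := leP T t; lra.
  have -> : S t - S s = (S t - step_sum T a k t) + (step_sum T a k t - step_sum T a k s)
     + (step_sum T a k s - S s) by ring.
  apply: (le_trans (ler_normD _ _)); apply: (le_trans (lerD (ler_normD _ _) (lexx _))).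
  rewrite distrC in kt.
  have Mk : M * stepsize k <= M * (e / (2 + M)) by rewrite ler_wpM2l// ltW.
  have eE : e = (2 + M) * (e / (2 + M)) by field; rewrite gt_eqF.
  move: D; rewrite mulrDr; rewrite eE in ks kt Mk *.
  move: ks kt Mk; rewrite -eE; lra.
move=> s t; have [st|ts] := leP s t.
  by rewrite distrC [in X in _ <= X]distrC [X in _ <= _ * X]ger0_norm ?subr_ge0// key.
rewrite [X in _ <= _ * X]ger0_norm; first exact: key (ltW ts).
by rewrite subr_ge0 ltW.
Qed.

(** The difference quotient of the limit is approximated by averages of slopes lying in the convex
    set [C], although the slopes themselves need not converge. *)
Lemma step_avg (R : realType) (U : set_system nat) (T M s t : R) (a : nat -> nat -> R)
    (S : R -> R) (C : set R) :
  UltraFilter U -> (\oo : set_system nat) `<=` U -> (forall k l, `|a k l| <= M) ->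
  (forall t, ulim U (fun k => step_sum T a k t) (S t)) ->
  convexR C -> T <= s -> s < t ->
  U [set k | forall l, (nsteps T k s <= l)%N -> (l < nsteps T k t)%N -> C (a k l)] ->
  closure C ((S t - S s) / (t - s)).
Proof.
move=> UU sU aM HS cC Ts st UC B /nbhs_ballP[e /= e0 eB].
have PU : ProperFilter U by exact: ultra_proper.
have M0 : 0 <= M := le_trans (normr_ge0 _) (aM 0%N 0%N).
have ts0 : 0 < t - s by rewrite subr_gt0.
pose e' := e * (t - s) / (3 + M).
have c0 : 0 < 3 + M by lra.
have e'0 : 0 < e' by rewrite divr_gt0// mulr_gt0.
(* A step shorter than [t - s] guarantees at least one step between [s] and [t], so that the average
   is over a nonempty range. *)
have h0 : 0 < Num.min e' (t - s) by rewrite lt_min e'0.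
have [k [[[/= ks kt] kh] kC]] := filter_ex (filterI (filterI (filterI (HS s _ e'0) (HS t _ e'0))
    (stepsize_small _ _ _ _ sU h0)) UC).
move: kh; rewrite lt_min => /andP[kh kts].
have hk0 := stepsize_gt0 R k.
pose m := (nsteps T k t - nsteps T k s)%N.
have Nst : (nsteps T k s <= nsteps T k t)%N by exact/nsteps_homo/ltW.
have mE : stepsize k * m%:R = stepsize k * (nsteps T k t)%:R - stepsize k * (nsteps T k s)%:R :> R.
  by rewrite natrB// mulrBr.
have [b1 b2] := nsteps_bounds _ T s k Ts.
have [b3 b4] := nsteps_bounds _ T t k (le_trans Ts (ltW st)).
have m0 : (0 < m)%N.
  rewrite lt0n; apply/eqP => m0; move: mE; rewrite m0 mulr0; lra.
pose D := step_sum T a k t - step_sum T a k s.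
have DE : D = stepsize k * \sum_(l < m) a k (nsteps T k s + l)%N by exact: step_sumB (ltW st).
pose v := (\sum_(l < m) a k (nsteps T k s + l)%N) / m%:R.
have Dv : D = v * (stepsize k * m%:R).
  rewrite DE /v; field; by rewrite pnatr_eq0 -lt0n.
exists v; split.
  have [m' mE'] : exists m', m = m'.+1 by exists m.-1; rewrite prednK.
  rewrite /v mE'.
  apply: (convexR_avg R C (fun l => a k (nsteps T k s + l)%N) m' cC) => l; rewrite -mE' => lm.
  by apply: kC; rewrite ?leq_addr// -(subnKC Nst) ltn_add2l.
apply: eB; rewrite /ball /=.
have vM : `|v| <= M.
  rewrite /v normrM normfV ler_pdivrMr ?normr_gt0 ?pnatr_eq0 -?lt0n// (ger0_norm (ler0n _ _)).
  apply: (le_trans (ler_norm_sum _ _ _)).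
  apply: (@le_trans _ _ (\sum_(l < m) M)); first by apply: ler_sum.
  by rewrite sumr_const card_ord mulr_natr.
have -> : (S t - S s) / (t - s) - v = (S t - S s - v * (t - s)) / (t - s).
  by rewrite [RHS]mulrBl mulfK ?gt_eqF.
rewrite normrM normfV (ger0_norm (ltW ts0)) ltr_pdivrMr//.
have -> : S t - S s - v * (t - s) = (S t - step_sum T a k t) + (step_sum T a k s - S s)
   + v * (stepsize k * m%:R - (t - s)) by rewrite [v * (stepsize k * _ - _)]mulrBr -Dv /D; ring.
apply: (le_lt_trans (ler_normD _ _)); apply: (le_lt_trans (lerD (ler_normD _ _) (lexx _))).
rewrite distrC in kt.
have H3 : `|v * (stepsize k * m%:R - (t - s))| <= M * e'.
  rewrite normrM; apply: ler_pM => //; rewrite mE ler_norml; apply/andP; split; lra.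
have -> : e * (t - s) = (3 + M) * e' by rewrite /e'; field; rewrite gt_eqF.
lra.
Qed.

(** Right-hand difference quotients lie in [closure C] by [step_avg], and [D] is their limit. *)
Lemma step_der (R : realType) (U : set_system nat) (T M t D : R) (a : nat -> nat -> R)
    (S : R -> R) (C : set R) :
  UltraFilter U -> (\oo : set_system nat) `<=` U -> (forall k l, `|a k l| <= M) ->
  (forall t, ulim U (fun k => step_sum T a k t) (S t)) ->
  convexR C -> T <= t -> has_der S t D ->
  (exists2 tau, 0 < tau & forall s, t < s -> s < t + tau ->
    U [set k | forall l, (nsteps T k t <= l)%N -> (l < nsteps T k s)%N -> C (a k l)]) ->
  closure C D.
Proof.
move=> UU sU aM HS cC Tt SD [tau tau0 H].
have cc : closed (closure C) by exact: closed_closure.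
rewrite ((closure_id (closure C)).1 cc) => B /nbhs_ballP[e /= e0 eB].
have e20 : 0 < e / 2 by rewrite divr_gt0.
have [d d0 Hd] := SD _ e20.
pose s := t + Num.min tau d / 2.
have m0 : 0 < Num.min tau d by rewrite lt_min tau0.
have md : Num.min tau d <= d by rewrite ge_min lexx orbT.
have mt : Num.min tau d <= tau by rewrite ge_min lexx.
have st : t < s by rewrite /s; lra.
have st0 : 0 < s - t by rewrite subr_gt0.
exists ((S s - S t) / (s - t)); split.
  apply: (step_avg R U T M t s a S C UU sU aM HS cC Tt st).
  by apply: H => //; rewrite /s; lra.
apply: eB; rewrite /ball /=.
have nst : `|s - t| = s - t by rewrite ger0_norm// ltW.
have := Hd s; rewrite nst => /(_ ltac:(rewrite /s; lra)) H'.
have -> : D - (S s - S t) / (s - t) = - ((S s - S t - D * (s - t)) / (s - t)).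
  by rewrite [in RHS]mulrBl mulfK ?gt_eqF// opprB.
rewrite normrN normrM normfV nst ltr_pdivrMr//.
apply: (le_lt_trans H'); rewrite ltr_pM2r//; lra.
Qed.

(** * Local existence by a clamped Euler scheme *)

Definition clamp {R : realType} (c a : R) : R := Num.max (c - 1) (Num.min a (c + 1)).

Lemma clamp_bound (R : realType) (c a : R) : `|clamp c a| <= `|c| + 1.
Proof.
have : `|clamp c a - c| <= 1.
  rewrite /clamp; have [h1|h1] := leP a (c + 1).
    by have [h2|h2] := leP (c - 1) a; rewrite ler_norml; lra.
  by have [h2|h2] := leP (c - 1) (c + 1); rewrite ler_norml; lra.
have := ler_normD (clamp c a - c) c; rewrite subrK; lra.
Qed.

Lemma clamp_lip (R : realType) (c a b : R) : `|clamp c a - clamp c b| <= `|a - b|.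
Proof.
have n1 := ler_norm (a - b); have n2 := ler_norm (b - a); rewrite distrC in n2.
rewrite /clamp; have [h1|h1] := leP a (c + 1); have [h2|h2] := leP b (c + 1);
 repeat match goal with |- context [Num.max ?x ?y] => case: (leP x y) => ? end;
 rewrite ler_norml; lra.
Qed.

Lemma clamp_id (R : realType) (c a : R) : `|a - c| <= 1 -> clamp c a = a.
Proof.
rewrite ler_distl => /andP[h1 h2]; rewrite /clamp.
by rewrite (min_idPl h2) (max_idPr h1).
Qed.

(** A crude bound for the operator norm in the maximum norm. *)
Definition mxbound {R : realType} {m n : nat} (M : 'M[R]_(m, n)) : R :=
  \sum_i \sum_j `|M i j|.

Lemma mxbound_ge0 (R : realType) (m n : nat) (M : 'M[R]_(m, n)) : 0 <= mxbound M.
Proof. by apply: sumr_ge0 => i _; apply: sumr_ge0. Qed.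

Lemma mulmx_bound (R : realType) (m n : nat) (M : 'M[R]_(m, n)) (z : 'cV[R]_n) (K : R) i :
  (forall j, `|z j 0| <= K) -> 0 <= K -> `|(M *m z) i 0| <= mxbound M * K.
Proof.
move=> zK K0; rewrite mxE; apply: (le_trans (ler_norm_sum _ _ _)).
apply: (@le_trans _ _ ((\sum_j `|M i j|) * K)).
  by rewrite mulr_suml; apply: ler_sum => j _; rewrite normrM ler_wpM2l.
rewrite ler_wpM2r// /mxbound (bigD1 i)//= lerDl sumr_ge0// => k _.
by apply: sumr_ge0.
Qed.

Lemma convexR_ball (R : realType) (c d : R) : convexR [set v : R | `|v - c| <= d].
Proof.
move=> x y l /= xd yd /andP[l0 l1].
have -> : l * x + (1 - l) * y - c = l * (x - c) + (1 - l) * (y - c) by ring.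
apply: (le_trans (ler_normD _ _)); rewrite !normrM (ger0_norm l0) (ger0_norm (_ : 0 <= 1 - l)) ?subr_ge0//.
have : l * `|x - c| <= l * d by rewrite ler_wpM2l.
have : (1 - l) * `|y - c| <= (1 - l) * d by rewrite ler_wpM2l// subr_ge0.
lra.
Qed.

Lemma convexR_hull (R : realType) (A : set R) : convexR (hullR A).
Proof. by move=> x y l hx hy l01 C [cC AC]; apply: (cC x y l) => //; [apply: hx|apply: hy]; split. Qed.

Lemma sub_hullR (R : realType) (A : set R) : A `<=` hullR A.
Proof. by move=> x Ax C [_]; exact. Qed.

(* The explicit Euler scheme is run with the state clamped to a box around the
   initial point, so that the vector field is bounded; its limit along an
   ultrafilter stays in that box for a positive time. *)
Lemma local_existence (R : realType) (n p : nat) (A : 'M[R]_n) (B : 'M[R]_(n, p))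
    (C : 'M[R]_(p, n)) (psi : 'I_p -> R -> R) (T : R) (x0 : 'cV[R]_n) :
  (forall i, piecewise_continuous (psi i)) ->
  exists h M : R, exists y : R -> 'cV[R]_n,
    [/\ 0 < h, y T = x0, forall i s t, `|y s i 0 - y t i 0| <= M * `|s - t| &
      {ae (@lebesgue_measure R), forall t, T <= t <= T + h ->
        vdiffble y t /\ Fk A B C psi (y t) (vderiv y t)}].
Proof.
move=> pcf.
have [U [UU sU]] := @ultraFilterLemma nat \oo _.
have PU : ProperFilter U by exact: ultra_proper.
pose cl (z : 'cV[R]_n) : 'cV[R]_n := \col_i clamp (x0 i 0) (z i 0).
pose nl (z : 'cV[R]_n) : 'cV[R]_p := \col_j psi j ((C *m cl z) j 0).
pose G (z : 'cV[R]_n) := A *m cl z - B *m nl z.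
pose X k l := iter l (fun z => z + stepsize k *: G z) x0.
pose K0 := \sum_i (`|x0 i 0| + 1).
have K00 : 0 <= K0 by apply: sumr_ge0 => i _; rewrite addr_ge0.
have clK z i : `|cl z i 0| <= K0.
  rewrite mxE; apply: (le_trans (clamp_bound _ _ _)).
  by rewrite /K0 (bigD1 i)//= lerDl sumr_ge0// => j _; rewrite addr_ge0.
have /choice[m Hm] j : exists m, 0 <= m /\ forall z, `|nl z j 0| <= m.
  have [m m0 H] := pc_bounded _ _ (pcf j) (mxbound C * K0).
  by exists m; split => // z; rewrite mxE; apply: H; exact: mulmx_bound.
pose Mb := \sum_j m j.
have Mb0 : 0 <= Mb by apply: sumr_ge0 => j _; have [] := Hm j.
have nlM z j : `|nl z j 0| <= Mb.
  have [_ /(_ z) H] := Hm j; apply: (le_trans H).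
  by rewrite /Mb (bigD1 j)//= lerDl sumr_ge0// => k _; have [] := Hm k.
pose Mc := mxbound A * K0.
have Mc0 : 0 <= Mc by rewrite mulr_ge0 ?mxbound_ge0.
have AM z i : `|(A *m cl z) i 0| <= Mc by exact: mulmx_bound.
(* The 1 makes [M] positive, so that [1 / M] can serve as lifetime: at speed [M] the limit then
   moves by at most 1, the half-width of the box. *)
pose M := Mc + mxbound B * Mb + 1.
have MB0 : 0 <= mxbound B * Mb by rewrite mulr_ge0 ?mxbound_ge0.
have M0 : 0 < M by rewrite /M; lra.
have GM z i : `|G z i 0| <= M.
  rewrite /G mxE [X in _ + X]mxE; apply: (le_trans (ler_normB _ _)).
  have := AM z i; have := mulmx_bound _ _ _ B (nl z) Mb i (nlM z) Mb0.
  rewrite /M; lra.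
have XE k l i : X k l i 0 = x0 i 0 + \sum_(l' < l) stepsize k * G (X k l') i 0.
  elim: l => [|l IH]; first by rewrite big_ord0 addr0.
  have -> : X k l.+1 = X k l + stepsize k *: G (X k l) by [].
  by rewrite mxE [X in _ + X]mxE IH big_ord_recr /= addrA.
(* The state, the nonlinear values and the linear part are accumulated separately: differentiating
   the limit [Sw] will produce the selection [w]. *)
have /choice[Sx HSx] i := step_limit R U T M (fun k l => G (X k l) i 0) UU sU (fun k l => GM _ i).
have /choice[Sw HSw] j := step_limit R U T Mb (fun k l => nl (X k l) j 0) UU sU (fun k l => nlM _ j).
have /choice[Sc HSc] i := step_limit R U T Mc (fun k l => (A *m cl (X k l)) i 0) UU sU (fun k l => AM _ i).
pose y (t : R) : 'cV[R]_n := \col_i (x0 i 0 + Sx i t).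
have yL i s t : `|y s i 0 - y t i 0| <= M * `|s - t|.
  by rewrite !mxE opprD addrACA subrr add0r; have [_ H _] := HSx i; exact: H.
have ySum i t : y t i 0 = x0 i 0 + Sc i t - \sum_j B i j * Sw j t.
  rewrite mxE -addrA; congr (_ + _).
  apply: (ulim_unique R U (fun k => step_sum T (fun k l => G (X k l) i 0) k t)).
    by have [H _ _] := HSx i; exact: H.
  rewrite (_ : (fun k => _) = (fun k => step_sum T (fun k l => (A *m cl (X k l)) i 0) k t
     + (-1) * \sum_j B i j * step_sum T (fun k l => nl (X k l) j 0) k t)); last first.
    apply/funext => k; rewrite /step_sum.
    have -> : \sum_j B i j * (\sum_(l < nsteps T k t) stepsize k * nl (X k l) j 0) =
        \sum_(l < nsteps T k t) \sum_j B i j * (stepsize k * nl (X k l) j 0).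
      by rewrite [RHS]exchange_big; apply: eq_bigr => j _; rewrite mulr_sumr.
    rewrite mulr_sumr -big_split /=; apply: eq_bigr => l _.
    rewrite /G mxE [X in _ * (_ + X)]mxE [X in _ * (_ - X)]mxE mulrBr; congr (_ + _).
    by rewrite mulN1r; congr (- _); rewrite mulr_sumr; apply: eq_bigr => j _; rewrite mulrCA.
  apply: ulimD; first by have [H _ _] := HSc i; exact: H.
  rewrite -[X in ulim _ _ X]mulN1r.
  apply: (ulimZ R U (-1) (fun k => \sum_j B i j * step_sum T (fun k l => nl (X k l) j 0) k t)).
  apply: (ulim_sum R U _ _ (fun j k => B i j * step_sum T (fun k l => nl (X k l) j 0) k t)) => j.
  apply: (ulimZ R U (B i j) (fun k => step_sum T (fun k l => nl (X k l) j 0) k t)).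
  by have [H _ _] := HSw j; exact: H.
have Xy t : T <= t -> forall d, 0 < d -> exists2 tau, 0 < tau & forall s, t < s -> s < t + tau ->
    U [set k | forall l, (nsteps T k t <= l)%N -> (l < nsteps T k s)%N ->
       forall i, `|X k l i 0 - y t i 0| <= d].
  (* Half of [d] is spent on the error at time [t], a quarter on the travel up to time [s], and a
     quarter on one step of rounding. *)
  move=> Tt d d0; have c0 : 0 < 4 * M by rewrite mulr_gt0.
  exists (d / (4 * M)); first exact: divr_gt0.
  move=> s ts std.
  have UX : U [set k | forall i, `|step_sum T (fun k l => G (X k l) i 0) k t - Sx i t| < d / 2].
    suff H (r : seq 'I_n) : U [set k | forall i, i \in r ->
        `|step_sum T (fun k l => G (X k l) i 0) k t - Sx i t| < d / 2].
      by apply: filterS (H (enum 'I_n)) => k Hk i; apply: Hk; rewrite mem_enum.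
    elim: r => [|i r IH]; first exact: filterE.
    have [Hi _ _] := HSx i; have d20 : 0 < d / 2 by rewrite divr_gt0.
    apply: filterS (filterI IH (Hi t _ d20)) => k [/= H1 H2] j.
    by rewrite inE => /orP[/eqP->//|/H1].
  have dM0 : 0 < d / (4 * M) by exact: divr_gt0.
  apply: filterS (filterI UX (stepsize_small _ _ _ _ sU dM0)) => k [/= H1 H2] l tl ls i.
  have -> : X k l i 0 - y t i 0 = (step_sum T (fun k l => G (X k l) i 0) k t - Sx i t)
      + (X k l i 0 - X k (nsteps T k t) i 0).
    by rewrite mxE (XE k (nsteps T k t)) /step_sum; ring.
  apply: (le_trans (ler_normD _ _)).
  suff : `|X k l i 0 - X k (nsteps T k t) i 0| <= d / 2 by have := H1 i; lra.
  rewrite !XE opprD addrACA subrr add0r.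
  rewrite -[in X in X - _](subnKC tl) big_split_ord /= addrAC subrr add0r.
  apply: (le_trans (ler_norm_sum _ _ _)).
  apply: (@le_trans _ _ (\sum_(l' < l - nsteps T k t) stepsize k * M)).
    apply: ler_sum => l' _; rewrite normrM (ger0_norm (ltW (stepsize_gt0 _ k))).
    by rewrite ler_wpM2l// ltW// stepsize_gt0.
  rewrite sumr_const card_ord -[X in X <= _]mulr_natr.
  apply: (@le_trans _ _ ((stepsize k * (nsteps T k s - nsteps T k t)%:R) * M)).
    rewrite mulrAC ler_wpM2r ?(ltW M0)// ler_wpM2l ?(ltW (stepsize_gt0 _ k))//.
    by rewrite ler_nat leq_sub2r// ltnW.
  rewrite natrB ?nsteps_homo ?(ltW ts)// mulrBr.
  have [b1 b2] := nsteps_bounds _ T t k Tt.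
  have [b3 b4] := nsteps_bounds _ T s k (le_trans Tt (ltW ts)).
  have -> : d / 2 = (d / (4 * M) + d / (4 * M)) * M by field; rewrite gt_eqF.
  rewrite ler_pM2r//; lra.
have clX k l t d i : `|X k l i 0 - y t i 0| <= d -> `|(cl (X k l) - cl (y t)) i 0| <= d.
  by move=> H; rewrite mxE [X in _ + X]mxE !mxE; apply: le_trans H; rewrite [X in _ <= `|_ - X|]mxE; exact: clamp_lip.
have mxcl q (N : 'M[R]_(q, n)) k l t d j : 0 <= d -> (forall i, `|X k l i 0 - y t i 0| <= d) ->
    `|(N *m cl (X k l)) j 0 - (N *m cl (y t)) j 0| <= mxbound N * d.
  move=> d0 H; have -> : (N *m cl (X k l)) j 0 - (N *m cl (y t)) j 0 = (N *m (cl (X k l) - cl (y t))) j 0.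
    by rewrite mulmxBr [in RHS]mxE [X in _ = _ + X]mxE.
  by apply: mulmx_bound => // i; apply: clX.
have aeD : {ae (@lebesgue_measure R), forall t, (forall j, derivable (Sw j) t 1) /\ (forall i, derivable (Sc i) t 1)}.
  apply: ae_and; apply: ae_ord => i.
    by have [_ H _] := HSw i; exact: lipschitz_ae_derivable Mb0 H.
  by have [_ H _] := HSc i; exact: lipschitz_ae_derivable Mc0 H.
exists (1 / M), M, y; split => //.
- by rewrite divr_gt0.
- by apply/matrixP => i j; rewrite ord1 mxE; have [_ _ ->] := HSx i; rewrite addr0.
apply: ae_mono aeD => t [dw dc] /andP[Tt tT].
have yid : cl (y t) = y t.
  apply/matrixP => i j; rewrite ord1 [LHS]mxE; apply: clamp_id.
  have -> : y t i 0 - x0 i 0 = Sx i t by rewrite mxE; ring.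
  have [_ H ST] := HSx i; have := H t T; rewrite ST subr0.
  move=> /le_trans; apply; rewrite ger0_norm ?subr_ge0// mulrC -ler_pdivlMr//; lra.
pose w : 'cV[R]_p := \col_j derive1 (Sw j) t.
have hw j : has_der (Sw j) t (w j 0) by apply/has_derP; rewrite mxE; split => //; exact: dw.
(* By continuity of the linear part, the slopes shortly after [t] lie in any given ball around this
   value, hence so does the derivative. *)
have hc i : has_der (Sc i) t ((A *m y t) i 0).
  have /has_derP : derivable (Sc i) t 1 /\ derive1 (Sc i) t = derive1 (Sc i) t by split => //; exact: dc.
  set D := derive1 _ _ => hD; suff <- : D = (A *m y t) i 0 by [].
  apply/eqP; rewrite -subr_eq0 -normr_eq0 eq_le normr_ge0 andbT.
  apply/ler_addgt0Pr => e e0; rewrite add0r.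
  have b0 : 0 < mxbound A + 1 by have := mxbound_ge0 R _ _ A; lra.
  have d0 : 0 < e / (mxbound A + 1) by exact: divr_gt0.
  have clb : closed [set v : R | `|v - (A *m y t) i 0| <= e].
    rewrite (_ : [set v | _] = closed_ball ((A *m y t) i 0) e); first exact: closed_ball_closed.
    by rewrite closed_ballE// /closed_ball_; apply/seteqP; split => v /=; rewrite distrC.
  suff : [set v : R | `|v - (A *m y t) i 0| <= e] D by [].
  rewrite ((closure_id _).1 clb).
  have [H _ _] := HSc i.
  apply: (step_der R U T Mc t D _ (Sc i) _ UU sU (fun k l => AM (X k l) i) H) => //.
    exact: convexR_ball.
  have [tau tau0 Ht] := Xy t Tt _ d0; exists tau => // s ts st.
  apply: filterS (Ht s ts st) => k Hk l l1 l2 /=.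
  rewrite -yid; apply: (le_trans (mxcl _ A k l t _ i (ltW d0) (Hk l l1 l2))).
  rewrite mulrC mulrAC ler_pdivrMr// ler_wpM2l ?(ltW e0)//; lra.
have hy i : has_der (fun s => y s i 0) t ((A *m y t - B *m w) i 0).
  rewrite (_ : (fun s => _) = (fun s => x0 i 0 + Sc i s + (-1) * \sum_j B i j * Sw j s)); last first.
    by apply/funext => s; rewrite ySum mulN1r.
  have -> : (A *m y t - B *m w) i 0 = 0 + (A *m y t) i 0 + (-1) * \sum_j B i j * w j 0.
    by rewrite add0r mulN1r mxE [X in _ + X]mxE [X in _ - X]mxE.
  apply: has_derD; first by apply: has_derD => //; exact: has_der_cst.
  by apply: has_derZ; apply: has_der_sum => j; exact: has_derZ.
split; first by move=> i; have /has_derP[] := hy i.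
exists w; split; last first.
  by apply/matrixP => i j; rewrite ord1 mxE; have /has_derP[_ ->] := hy i.
(* Shortly after [t] the arguments of [psi j] are within [d] of the output at [t], so the slopes lie
   in the hull of the corresponding window and [w] in its closure. *)
move=> j d /= d0.
have b0 : 0 < mxbound C + 1 by have := mxbound_ge0 R _ _ C; lra.
have d'0 : 0 < d / (mxbound C + 1) by exact: divr_gt0.
have [H _ _] := HSw j.
apply: (step_der R U T Mb t (w j 0) _ (Sw j) _ UU sU (fun k l => nlM (X k l) j) H) => //.
  exact: convexR_hull.
have [tau tau0 Ht] := Xy t Tt _ d'0; exists tau => // s ts st.
apply: filterS (Ht s ts st) => k Hk l l1 l2 /=.
apply: sub_hullR; exists ((C *m cl (X k l)) j 0); last by rewrite [RHS]mxE.
rewrite /= -ler_distl -yid.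
apply: (le_trans (mxcl _ C k l t _ j (ltW d'0) (Hk l l1 l2))).
rewrite mulrC mulrAC ler_pdivrMr// ler_wpM2l ?(ltW d0)//; lra.
Qed.

(** * Continuation of solutions *)

Lemma ac_on_gt (R : realType) (a b : R) (f : R -> R) : b < a -> ac_on a b f.
Proof.
move=> ba e e0; exists 1 => // -[|N] u v uv _ _; first by rewrite big_ord0.
have [a1 [a2 a3]] := uv 0%N (ltn0Sn _).
by move: (le_lt_trans (le_trans a1 (le_trans a2 a3)) ba); rewrite ltxx.
Qed.

Lemma ac_on_congr (R : realType) (a b : R) (f g : R -> R) :
  (forall t, a <= t -> t <= b -> f t = g t) -> ac_on a b f -> ac_on a b g.
Proof.
move=> fg acf; apply: (ac_on_dom _ _ _ 1 f) => // u v au uv vb.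
by rewrite mul1r -!fg//; [exact: le_trans uv vb|exact: le_trans au uv].
Qed.

Lemma ac_on_lip (R : realType) (a b M : R) (f : R -> R) :
  (forall s t, a <= s -> s <= t -> t <= b -> `|f t - f s| <= M * (t - s)) -> ac_on a b f.
Proof.
move=> fM; apply: (ac_on_dom _ _ _ M id); first exact: ac_on_id.
by move=> u v au uv vb; rewrite [X in _ <= _ * X]ger0_norm ?subr_ge0//; exact: fM.
Qed.

(** Every interval is cut at [c] by [min] and [max]; the pieces stay ordered and no longer than
    before, and degenerate ones contribute 0. *)
Lemma ac_on_glue (R : realType) (a c b : R) (f : R -> R) : a <= c -> c <= b ->
  ac_on a c f -> ac_on c b f -> ac_on a b f.
Proof.
move=> ac cb acf bcf e e0; have e20 : 0 < e / 2 by rewrite divr_gt0.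
have [d1 d10 H1] := acf _ e20; have [d2 d20 H2] := bcf _ e20.
exists (Num.min d1 d2); first by rewrite lt_min d10.
move=> N u v uv uv'; rewrite lt_min => /andP[s1 s2].
have K1 : \sum_(k < N) `|f (Num.min (v k) c) - f (Num.min (u k) c)| < e / 2.
  apply: (H1 N (fun k => Num.min (u k) c) (fun k => Num.min (v k) c)).
  - move=> k kN; have [a1 [a2 a3]] := uv k kN; split; first by rewrite le_min a1.
    split; first by rewrite le_min !ge_min a2 lexx orbT.
    by rewrite ge_min lexx orbT.
  - by move=> k kN; rewrite le_min !ge_min uv'// lexx orbT.
  - apply: (le_lt_trans _ s1); apply: ler_sum => k _.
    have [a1 [a2 a3]] := uv k (ltn_ord k).
    by have [h1|h1] := leP (v k) c; have [h2|h2] := leP (u k) c; lra.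
have K2 : \sum_(k < N) `|f (Num.max (v k) c) - f (Num.max (u k) c)| < e / 2.
  apply: (H2 N (fun k => Num.max (u k) c) (fun k => Num.max (v k) c)).
  - move=> k kN; have [a1 [a2 a3]] := uv k kN; split; first by rewrite le_max lexx orbT.
    split; first by rewrite ge_max !le_max a2 lexx orbT.
    by rewrite ge_max a3.
  - by move=> k kN; rewrite ge_max !le_max uv'// lexx orbT.
  - apply: (le_lt_trans _ s2); apply: ler_sum => k _.
    have [a1 [a2 a3]] := uv k (ltn_ord k).
    by have [h1|h1] := leP (v k) c; have [h2|h2] := leP (u k) c; lra.
have -> : e = e / 2 + e / 2 by field.
apply: le_lt_trans (ltrD K1 K2); rewrite -big_split /=; apply: ler_sum => k _.
have [h1|h1] := leP (v k) c; have [h2|h2] := leP (u k) c.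
- by rewrite subrr normr0 addr0.
- by have [a1 [a2 a3]] := uv k (ltn_ord k); move: (lt_le_trans h2 (le_trans a2 h1)); rewrite ltxx.
- by rewrite [X in _ <= X]addrC -{1}(subrK (f c) (f (v k))) -addrA ler_normD.
- by rewrite subrr normr0 add0r.
Qed.

Lemma ac_on_itv_glue (R : realType) (J : interval R) (c : R) (f : R -> R) : c \in J ->
  (forall a b, a \in J -> b \in J -> a <= b -> b <= c -> ac_on a b f) ->
  (forall a b, a \in J -> b \in J -> c <= a -> a <= b -> ac_on a b f) ->
  forall a b, a \in J -> b \in J -> ac_on a b f.
Proof.
move=> cJ Hl Hr a b aJ bJ; have [ab|/ac_on_gt//] := leP a b.
have [bc|cb] := leP b c; first exact: Hl.
have [ca|ac] := leP c a; first exact: Hr.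
by apply: (ac_on_glue _ _ c); rewrite ?(ltW ac) ?(ltW cb)//; [apply: Hl|apply: Hr] => //; exact: ltW.
Qed.

Lemma vder_congr (R : realType) (n : nat) (x z : R -> 'cV[R]_n) (t d : R) : 0 < d ->
  (forall s, `|s - t| < d -> z s = x s) -> vdiffble x t ->
  vdiffble z t /\ vderiv z t = vderiv x t.
Proof.
move=> d0 zx dx.
have H i : has_der (fun s => z s i 0) t (vderiv x t i 0).
  apply: (has_der_congr R (fun s => x s i 0) _ t _ d d0); first by move=> s sd; rewrite zx.
  by apply/has_derP; rewrite mxE; split => //; exact: dx.
split; first by move=> i; have /has_derP[] := H i.
by apply/matrixP => i j; rewrite ord1 [LHS]mxE; have /has_derP[_ ->] := H i.
Qed.

Lemma ae_bounded_der_lip (R : realType) (f : R -> R) (a b M : R) : a <= b -> ac_on a b f ->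
  {ae (@lebesgue_measure R), forall t, a <= t <= b ->
     derivable f t 1 /\ `|derive1 f t| <= M} ->
  `|f b - f a| <= M * (b - a).
Proof.
move=> ab acf aeM.
(* Both [f t - M * t] and [- f t - M * t] are nonincreasing. *)
have key c : c = 1 \/ c = -1 -> c * f b + (- M) * b <= c * f a + (- M) * a.
  move=> c1.
  apply: (@ac_nonincreasing R (fun s => c * f s + (- M) * s)) => //.
    by apply: ac_onD; apply: ac_onZ => //; exact: ac_on_id.
  apply: ae_mono aeM => t H /H[df dM].
  have /has_derP hf : derivable f t 1 /\ derive1 f t = derive1 f t by [].
  have dq : has_der (fun r : R => - M * r) t (- M * 1).
    apply: has_derZ; move=> e e0; exists 1 => // u _.
    by rewrite mul1r subrr normr0 mulr_ge0// ltW.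
  have /has_derP[dd ->] := has_derD _ _ _ _ _ _ (has_derZ _ _ c _ _ hf) dq; split => //.
  move: dM; rewrite ler_norml => /andP[? ?]; case: c1 => ->; lra.
have := key 1 (or_introl erefl); have := key (-1) (or_intror erefl).
rewrite ler_norml; lra.
Qed.

Lemma solution_extend_closed (R : realType) (n p : nat) (A : 'M[R]_n) (B : 'M[R]_(n, p))
    (C : 'M[R]_(p, n)) (psi : 'I_p -> R -> R) (l : itv_bound R) (T : R) (x : R -> 'cV[R]_n) :
  (forall i, piecewise_continuous (psi i)) ->
  is_solution (Fk A B C psi) (Interval l (BRight T)) x ->
  exists2 h, 0 < h & exists2 z, is_solution (Fk A B C psi) (Interval l (BRight (T + h))) z &
    forall t, t <= T -> z t = x t.
Proof.
move=> pcf [I0 [acI aeI]].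
have [h [M [y [h0 yT yL aey]]]] := local_existence R n p A B C psi T (x T) pcf.
exists h => //; exists (fun t => if t <= T then x t else y t); last by move=> t ->.
have lT : (l <= BLeft T)%O.
  move: I0; rewrite itv_boundlr => /andP[l0 /= T0]; apply: (le_trans l0).
  by rewrite bnd_simp in T0 *.
have memI t : t \in Interval l (BRight (T + h)) -> t <= T -> t \in Interval l (BRight T).
  by rewrite !itv_boundlr => /andP[-> _] /= tT; rewrite bnd_simp.
split; last split.
- move: I0; rewrite !itv_boundlr => /andP[-> /=]; rewrite bnd_simp => T0.
  by rewrite bnd_simp; lra.
- move=> a b aJ bJ; apply: abs_cont_on_comp => i; move: a b aJ bJ.
  apply: (ac_on_itv_glue _ _ T).
  + by rewrite itv_boundlr lT /= bnd_simp; lra.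
  + move=> a b aJ bJ ab bT; apply: (ac_on_congr _ _ _ (fun s => x s i 0)).
      by move=> t at_ tb; rewrite (le_trans tb bT).
    by apply: ac_on_comp; apply: acI; apply: memI => //; exact: le_trans ab bT.
  + move=> a b aJ bJ Ta ab; apply: (ac_on_congr _ _ _ (fun s => y s i 0)).
      move=> t at_ tb; case: ifPn => // tT.
      suff -> : t = T by rewrite yT.
      by apply/eqP; rewrite eq_le tT (le_trans Ta).
    apply: (ac_on_lip _ _ _ M) => s t as_ st tb.
    by have := yL i t s; rewrite [X in _ <= _ * X]ger0_norm ?subr_ge0.
(* At the junction the glued function may have a corner; this single time is discarded. *)
- have c0 : countable [set T] by apply: finite_set_countable; exact: finite_set1.
  have := ae_and _ _ _ aeI (ae_and _ _ _ aey (ae_countable _ _ c0)).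
  apply: ae_mono => t [Hx [Hy /eqP tT]] tJ.
  have [lt|gt|/eqP] := ltgtP t T; last by rewrite (negbTE tT).
  + have d0 : 0 < T - t by rewrite subr_gt0.
    have [dx Fx] := Hx (memI t tJ (ltW lt)).
    have [] := vder_congr R n x (fun t => if t <= T then x t else y t) t (T - t) d0 _ dx.
      by move=> s /ltr_dist_bounds[_ sT]; rewrite ifT//; lra.
    by move=> dz ->; split => //; rewrite (ltW lt).
  + have d0 : 0 < t - T by rewrite subr_gt0.
    have [|dy Fy] := Hy.
      move: tJ; rewrite /= itv_boundlr => /andP[_ /= tTh]; rewrite bnd_simp in tTh.
      by rewrite (ltW gt).
    have [] := vder_congr R n y (fun t => if t <= T then x t else y t) t (t - T) d0 _ dy.
      by move=> s /ltr_dist_bounds[sT _]; rewrite ifF//; apply/negbTE; rewrite -ltNge; lra.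
    by move=> dz ->; split => //; rewrite leNgt gt.
Qed.

Lemma Fk_bounded (R : realType) (n p : nat) (A : 'M[R]_n) (B : 'M[R]_(n, p))
    (C : 'M[R]_(p, n)) (psi : 'I_p -> R -> R) (K : R) :
  (forall i, piecewise_continuous (psi i)) -> 0 <= K ->
  exists2 M, 0 <= M & forall x v : 'cV[R]_n, (forall i, `|x i 0| <= K) -> Fk A B C psi x v ->
    forall i, `|v i 0| <= M.
Proof.
move=> pcf K0.
have /choice[m Hm] j : exists m, 0 <= m /\ forall s w, `|s| <= mxbound C * K ->
    krasovskii (psi j) s w -> `|w| <= m.
  by have [m m0 H] := krasovskii_bounded R (psi j) (pcf j) (mxbound C * K); exists m.
pose Mb := \sum_j m j.
have Mb0 : 0 <= Mb by apply: sumr_ge0 => j _; have [] := Hm j.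
exists (mxbound A * K + mxbound B * Mb).
  by rewrite addr_ge0 ?mulr_ge0 ?mxbound_ge0.
move=> x v xK [w [kw ->]] i.
have wM j : `|w j 0| <= Mb.
  have [_ H] := Hm j; apply: (le_trans (H _ _ (mulmx_bound _ _ _ C x K j xK K0) (kw j))).
  by rewrite /Mb (bigD1 j)//= lerDl sumr_ge0// => k _; have [] := Hm k.
rewrite mxE [X in _ + X]mxE; apply: (le_trans (ler_normB _ _)).
by apply: lerD; exact: mulmx_bound.
Qed.

(* A bounded solution is Lipschitz, and sup (x_i(s) - M (T - s)) is its left limit
   at T. *)
Lemma solution_extend_open (R : realType) (n p : nat) (A : 'M[R]_n) (B : 'M[R]_(n, p))
    (C : 'M[R]_(p, n)) (psi : 'I_p -> R -> R) (l : itv_bound R) (T K : R) (x : R -> 'cV[R]_n) :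
  (forall i, piecewise_continuous (psi i)) -> 0 <= K ->
  (forall t, 0 <= t -> t < T -> forall i, `|x t i 0| <= K) ->
  is_solution (Fk A B C psi) (Interval l (BLeft T)) x ->
  exists2 z, is_solution (Fk A B C psi) (Interval l (BRight T)) z &
    forall t, t < T -> z t = x t.
Proof.
move=> pcf K0 xK [I0 [acI aeI]].
have [M M0 HM] := Fk_bounded R n p A B C psi K pcf K0.
have [l0 T0] : (l <= BLeft 0)%O /\ 0 < T.
  by move: I0; rewrite itv_boundlr => /andP[-> /=]; rewrite bnd_simp.
have memI t : t \in Interval l (BRight T) -> t < T -> t \in Interval l (BLeft T).
  by rewrite !itv_boundlr => /andP[-> _] /= tT; rewrite bnd_simp.
have memI0 t : 0 <= t -> t < T -> t \in Interval l (BLeft T).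
  by move=> t0 tT; rewrite itv_boundlr /= !bnd_simp tT andbT (le_trans l0)// bnd_simp.
have xL i s t : 0 <= s -> s <= t -> t < T -> `|x t i 0 - x s i 0| <= M * (t - s).
  move=> s0 st tT.
  apply: (@ae_bounded_der_lip R (fun s => x s i 0)) => //.
    by apply: ac_on_comp; apply: acI; apply: memI0; rewrite ?(le_trans s0)// (le_lt_trans st).
  apply: ae_mono aeI => r Hr /andP[sr rt].
  have r0 : 0 <= r by exact: le_trans sr.
  have rT : r < T by exact: le_lt_trans tT.
  have [dx Fx] := Hr (memI0 r r0 rT); split; first exact: dx.
  by have := HM _ _ (xK r r0 rT) Fx i; rewrite mxE.
pose E i := [set x s i 0 - M * (T - s) | s in [set s | 0 <= s < T]].
have Eub i s : 0 <= s -> s < T -> forall v, E i v -> v <= x s i 0 + M * (T - s).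
  move=> s0 sT _ [r /= /andP[r0 rT] <-].
  have [rs|sr] := leP r s.
    have := xL i r s r0 rs sT; rewrite ler_norml => /andP[h1 h2].
    have : 0 <= M * (T - s) by rewrite mulr_ge0// subr_ge0 ltW.
    rewrite !mulrBr in h1 h2 *; lra.
  have := xL i s r s0 (ltW sr) rT; rewrite ler_norml => /andP[h1 h2].
  have : 0 <= M * (T - r) by rewrite mulr_ge0// subr_ge0 ltW.
  rewrite !mulrBr in h1 h2 *; lra.
pose L : 'cV[R]_n := \col_i sup (E i).
have LE i s : 0 <= s -> s < T -> `|L i 0 - x s i 0| <= M * (T - s).
  move=> s0 sT; rewrite mxE ler_distl; apply/andP; split.
    apply: sup_upper_bound; last by exists s => //=; rewrite s0.
    split; first by exists (x s i 0 - M * (T - s)), s => //=; rewrite s0.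
    by exists (x s i 0 + M * (T - s)) => v; exact: Eub.
  apply: ge_sup; first by exists (x s i 0 - M * (T - s)), s => //=; rewrite s0.
  by move=> v; exact: Eub.
exists (fun t => if t < T then x t else L); last by move=> t ->.
split; last split.
- by rewrite itv_boundlr l0 /= bnd_simp ltW.
- move=> a b aJ bJ; apply: abs_cont_on_comp => i; move: a b aJ bJ.
  (* The Lipschitz bound holds from time 0 on only; before it the absolute continuity of [x] itself
     is used. *)
  apply: (ac_on_itv_glue _ _ 0).
  + by rewrite itv_boundlr l0 /= bnd_simp ltW.
  + move=> a b aJ bJ ab b0; apply: (ac_on_congr _ _ _ (fun s => x s i 0)).
      by move=> t at_ tb; rewrite (le_lt_trans (le_trans tb b0) T0).
    have bT : b < T by exact: le_lt_trans b0 T0.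
    by apply: ac_on_comp; apply: acI; apply: memI => //; exact: le_lt_trans ab bT.
  + move=> a b aJ bJ a0 ab; apply: (ac_on_lip _ _ _ M) => s t as_ st tb.
    have s0 : 0 <= s by exact: le_trans as_.
    have tT : t <= T by move: bJ; rewrite itv_boundlr => /andP[_ /=]; rewrite bnd_simp => /(le_trans tb).
    have [tT'|Tt] := ltP t T.
      by rewrite (le_lt_trans st tT'); exact: xL.
    have -> : t = T by apply/eqP; rewrite eq_le tT.
    have [sT|Ts] := ltP s T; first exact: LE.
    by rewrite subrr normr0 mulr_ge0// subr_ge0; apply: le_trans tT.
- have c0 : countable [set T] by apply: finite_set_countable; exact: finite_set1.
  have := ae_and _ _ _ aeI (ae_countable _ _ c0).
  apply: ae_mono => t [Hx /eqP tT] tJ.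
  have lt : t < T.
    rewrite lt_neqAle tT /=; move: tJ; rewrite /= itv_boundlr => /andP[_ /=].
    by rewrite bnd_simp.
  have d0 : 0 < T - t by rewrite subr_gt0.
  have [dx Fx] := Hx (memI t tJ lt).
  have [] := vder_congr R n x (fun t => if t < T then x t else L) t (T - t) d0 _ dx.
    by move=> s /ltr_dist_bounds[_ sT]; rewrite ifT//; lra.
  by move=> dz ->; split => //; rewrite lt.
Qed.

(** * The KL estimate *)

Lemma prim_continuous (R : realType) (f : R -> R) : piecewise_continuous f ->
  continuous (prim f).
Proof.
move=> pcf x; apply/continuous_ed => e e0.
have [M M0 HM] := prim_lip _ _ pcf (`|x| + 1).
have M1 : 0 < M + 1 by lra.
exists (Num.min 1 (e / (M + 1))); first by rewrite lt_min ltr01 divr_gt0.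
move=> y; rewrite lt_min => /andP[y1 ye].
have yK : `|y| <= `|x| + 1 by have := ler_normD (y - x) x; rewrite subrK; lra.
apply: (le_lt_trans (HM x y _ yK)); first by rewrite lerDl.
apply: (@le_lt_trans _ _ ((M + 1) * `|y - x|)); first by rewrite ler_wpM2r// lerDl.
by rewrite mulrC -ltr_pdivlMr.
Qed.

Lemma continuous_sum (R : realType) (I : Type) (r : seq I) (f : I -> R -> R) :
  (forall i, continuous (f i)) -> continuous (fun s => \sum_(i <- r) f i s).
Proof.
move=> H; elim: r => [|i r IH].
  rewrite (_ : (fun s => _) = (fun=> 0)); first exact: cst_continuous.
  by apply/funext => s; rewrite big_nil.
rewrite (_ : (fun s => _) = (fun s => f i s + \sum_(j <- r) f j s)).
  by move=> x; apply: continuousD; [exact: H|exact: IH].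
by apply/funext => s; rewrite big_cons.
Qed.

Lemma lyapunov_upper (R : realType) (n p : nat) (C : 'M[R]_(p, n)) (psi : 'I_p -> R -> R)
    (g : 'rV[R]_p) (P : 'M[R]_n) :
  (forall i, piecewise_continuous (psi i)) -> (forall i s, 0 <= psi i s * s) ->
  (forall i, 0 < g 0 i) ->
  exists a : R -> R, [/\ continuous a, a 0 = 0,
    forall r s, 0 <= r -> r < s -> a r < a s &
    forall x, lyapunov C psi g P x <= a (vnorm x)].
Proof.
move=> pcf sgn g0.
pose c := mxbound C; have c0 : 0 <= c := mxbound_ge0 R _ _ C.
(* The 1 makes the quadratic term strictly increasing, even when [mxbound P] or [n] is 0. *)
pose cP := mxbound P *+ n + 1.
have cP0 : 0 < cP by rewrite ltr_wpDl// mulrn_wge0// mxbound_ge0.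
(* The sign of the output is unknown: both branches of the primitive are added, each nonnegative and
   nondecreasing in [r >= 0]. *)
pose f i (r : R) := 2 * (g 0 i * (prim (psi i) (c * r) + prim (psi i) (- (c * r)))).
exists (fun r => cP * (r * r) + \sum_i f i r); split.
- have cid : continuous (fun r : R => r) by move=> r; exact: cvg_id.
  have ccst (k : R) : continuous (fun _ : R => k) by exact: cst_continuous.
  have h1 : continuous (fun r : R => cP * (r * r)).
    by move=> r; exact: cvgM (ccst cP r) (cvgM (cid r) (cid r)).
  have cl : continuous (fun r : R => c * r).
    by move=> r; exact: cvgM (ccst c r) (cid r).
  have clN : continuous (fun r : R => - (c * r)).
    by move=> r; exact: cvgN (cl r).
  have h2 i : continuous (f i).
    move=> r; apply: cvgM (ccst 2 r) _; apply: cvgM (ccst (g 0 i) r) _; apply: cvgD.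
      by apply: continuous_comp; [exact: cl|exact: prim_continuous].
    by apply: (@continuous_comp _ _ _ (fun x : R => - (c * x)) (prim (psi i)) r);
      [exact: clN|exact: prim_continuous].
  by move=> r; exact: cvgD (h1 r) (continuous_sum R _ _ f h2 r).
- rewrite mul0r mulr0 add0r big1// => i _.
  by rewrite /f mulr0 oppr0 prim0 addr0 !mulr0.
- move=> r s r0 rs; apply: ltr_leD.
    rewrite ltr_pM2l// -!expr2 ltr_pXn2r// nnegrE// ltW//; exact: le_lt_trans rs.
  apply: ler_sum => i _; rewrite /f !ler_pM2l ?g0//.
  have crs : c * r <= c * s by rewrite ler_wpM2l// ltW.
  have cr0 : 0 <= c * r by rewrite mulr_ge0.
  have [H1 H2] := prim_monotone _ _ (pcf i) (sgn i).
  by apply: lerD; [exact: H1|apply: H2; rewrite ?lerN2// oppr_le0].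
- move=> x; apply: lerD.
    rewrite qform_sum; apply: (@le_trans _ _ (\sum_(i < n) mxbound P * (vnorm x * vnorm x))).
      apply: ler_sum => i _; apply: (le_trans (ler_norm _)); rewrite normrM mulrCA.
      apply: ler_pM => //; first exact: comp_le_vnorm.
      by apply: mulmx_bound => [j|]; [exact: comp_le_vnorm|exact: vnorm_ge0].
    rewrite sumr_const card_ord -mulrnAl ler_wpM2r ?mulr_ge0 ?vnorm_ge0// /cP.
    by rewrite lerDl.
  apply: ler_sum => i _; rewrite /f !ler_pM2l ?g0//.
  have yb : `|(C *m x) i 0| <= c * vnorm x.
    by apply: mulmx_bound => [j|]; [exact: comp_le_vnorm|exact: vnorm_ge0].
  have [y1 y2] : - (c * vnorm x) <= (C *m x) i 0 /\ (C *m x) i 0 <= c * vnorm x.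
    by apply/andP; rewrite -ler_norml.
  have [H1 H2] := prim_monotone _ _ (pcf i) (sgn i).
  have p1 := prim_ge0 _ _ (pcf i) (sgn i) (c * vnorm x).
  have p2 := prim_ge0 _ _ (pcf i) (sgn i) (- (c * vnorm x)).
  have [y0|y0] := leP 0 ((C *m x) i 0).
    by have := H1 _ _ y0 y2; lra.
  by have := H2 _ _ y1 (ltW y0); lra.
Qed.

(** The inner root bounds |x| at the favourable time, [a] converts it into a bound of V, and the
    coercivity constant [l] with the outer root converts that back into a bound of |x| at time
    [t]. *)
Definition kl_bound {R : realType} (a : R -> R) (eta l r t : R) : R :=
  Num.sqrt (a (Num.sqrt ((a r / eta + r ^+ 2) / (1 + t))) / l).

Lemma kl_bound_classKL (R : realType) (a : R -> R) (eta l : R) : 0 < eta -> 0 < l ->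
  continuous a -> a 0 = 0 -> (forall r s, 0 <= r -> r < s -> a r < a s) ->
  classKL (kl_bound a eta l).
Proof.
move=> eta0 l0 ca a0 incr.
have mono r s : 0 <= r -> r <= s -> a r <= a s.
  by move=> r0; rewrite le_eqVlt => /orP[/eqP->//|rs]; exact/ltW/incr.
have apos r : 0 <= r -> 0 <= a r by move=> r0; rewrite -a0; exact: mono.
have Qpos r t : 0 <= r -> 0 <= t -> 0 <= (a r / eta + r ^+ 2) / (1 + t).
  move=> r0 t0; rewrite divr_ge0// ?addr_ge0// ?sqr_ge0//.
  by rewrite divr_ge0 ?apos// ltW.
split.
- move=> t t0; have t1 : 0 < 1 + t by lra.
  split; last split.
  + apply: continuous_subspaceT => r.
    have cin : {for r, continuous (fun r : R => (a r / eta + r ^+ 2) / (1 + t))}.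
      apply: continuousM; last exact: cst_continuous.
      apply: continuousD; last exact: exprn_continuous.
      by apply: continuousM; [exact: ca|exact: cst_continuous].
    have csq : {for r, continuous (fun r : R => Num.sqrt ((a r / eta + r ^+ 2) / (1 + t)))}.
      by apply: (continuous_comp cin); exact: sqrt_continuous.
    have ca2 : {for r, continuous (fun r : R => a (Num.sqrt ((a r / eta + r ^+ 2) / (1 + t))) / l)}.
      apply: continuousM; last exact: cst_continuous.
      by apply: (continuous_comp csq); exact: ca.
    by apply: (continuous_comp ca2); exact: sqrt_continuous.
  + by rewrite /kl_bound a0 mul0r expr0n /= addr0 mul0r sqrtr0 a0 mul0r sqrtr0.
  + move=> r s r0 rs; have s0 : 0 < s by exact: le_lt_trans rs.
    have Q : (a r / eta + r ^+ 2) / (1 + t) < (a s / eta + s ^+ 2) / (1 + t).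
      rewrite ltr_pM2r ?invr_gt0//; apply: ltrD; first by rewrite ltr_pM2r ?invr_gt0// incr.
      by rewrite ltr_pXn2r// nnegrE// ltW.
    have Qs : 0 < (a s / eta + s ^+ 2) / (1 + t) by exact: le_lt_trans (Qpos r t r0 t0) Q.
    have : Num.sqrt ((a r / eta + r ^+ 2) / (1 + t)) < Num.sqrt ((a s / eta + s ^+ 2) / (1 + t)).
      by rewrite ltr_sqrt.
    move=> /(incr _ _ (sqrtr_ge0 _)) H.
    rewrite /kl_bound ltr_sqrt; first by rewrite ltr_pM2r ?invr_gt0.
    by rewrite divr_gt0//; apply: le_lt_trans H; apply: apos; exact: sqrtr_ge0.
- move=> r r0; split.
  + move=> s t s0 st; have t0 : 0 <= t by exact: le_trans st.
    rewrite /kl_bound; apply: ler_wsqrtr; rewrite ler_pM2r ?invr_gt0//; apply: mono.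
      exact: sqrtr_ge0.
    apply: ler_wsqrtr; rewrite ler_wpM2l//.
      by rewrite addr_ge0 ?sqr_ge0// divr_ge0 ?apos// ltW.
    by rewrite lef_pV2 ?posrE; lra.
  + apply/cvgrPdist_lt => e e0.
    pose c := a r / eta + r ^+ 2.
    have c0 : 0 <= c by rewrite addr_ge0 ?sqr_ge0// divr_ge0 ?apos// ltW.
    (* The bound is below [e] once [a] of the inner root is below [l * e ^+ 2]; continuity of [a] at
       0 gives the radius [d], reached when [t > c / d ^+ 2]. *)
    have le0 : 0 < l * e ^+ 2 by rewrite mulr_gt0// exprn_gt0.
    have /continuous_ed/(_ _ le0)[d d0 Hd] := ca 0.
    have d20 : 0 < d ^+ 2 by rewrite exprn_gt0.
    near=> t.
    have t0 : 0 <= t by near: t; exact: nbhs_pinfty_ge.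
    have ct : c / d ^+ 2 < t by near: t; apply: nbhs_pinfty_gt; exact: num_real.
    have q : Num.sqrt (c / (1 + t)) < d.
      rewrite -[X in _ < X](ger0_norm (ltW d0)) -sqrtr_sqr ltr_sqrt//.
      rewrite ltr_pdivrMr; last lra.
      rewrite ltr_pdivrMr// in ct; nra.
    have q0 := sqrtr_ge0 (c / (1 + t)).
    have := Hd (Num.sqrt (c / (1 + t))); rewrite subr0 (ger0_norm q0) => /(_ q).
    rewrite a0 subr0 (ger0_norm (apos _ q0)) => H.
    rewrite sub0r normrN ger0_norm ?sqrtr_ge0// /kl_bound -/c.
    rewrite -[X in _ < X](ger0_norm (ltW e0)) -[X in _ < X]sqrtr_sqr ltr_sqrt ?exprn_gt0//.
    by rewrite ltr_pdivrMr// [X in _ < X]mulrC.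
Unshelve. all: by end_near. Qed.

Theorem theorem1 (R : realType) (n p : nat) (A : 'M[R]_n) (B : 'M[R]_(n, p))
    (C : 'M[R]_(p, n)) (psi : 'I_p -> R -> R) (zeta : 'I_p -> \bar R) :
  assumption1 psi zeta -> assumption2 A B C zeta ->
  (forall (I : interval R) (x : R -> 'cV[R]_n),
      maximal_solution (Fk A B C psi) I x -> [set t : R | 0 <= t] `<=` [set` I]) /\
  exists beta : R -> R -> R, classKL beta /\
    forall (I : interval R) (x : R -> 'cV[R]_n),
      is_solution (Fk A B C psi) I x ->
      forall t, t \in I -> 0 <= t -> vnorm (x t) <= beta (vnorm (x 0)) t.
Proof.
move=> A1 [g [P [eta [g0 [Psym [Ppos [eta0 lmi]]]]]]].
have pcf i : piecewise_continuous (psi i) by have [] := A1 i.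
have sgn i s : 0 <= psi i s * s.
  by have [_ [z0 sc]] := A1 i; exact: sector_sign z0 sc s.
have [l l0 Hl] := pos_def_coercive R n P Psym Ppos.
have Vlow (x : 'cV[R]_n) : l * \sum_i (x i 0) ^+ 2 <= lyapunov C psi g P x.
  apply: (le_trans (Hl x)); rewrite lerDl sumr_ge0// => i _.
  by rewrite mulr_ge0// mulr_ge0 ?(ltW (g0 i))//; exact: prim_ge0.
have decay := fun (I : interval R) (x : R -> 'cV[R]_n) sol => lyapunov_decay R n p A B C psi zeta g P eta I x A1 Psym (ltW eta0) lmi sol.
have Vdec (I : interval R) (x : R -> 'cV[R]_n) : is_solution (Fk A B C psi) I x -> forall s t, s \in I -> t \in I -> s <= t ->
    lyapunov C psi g P (x t) <= lyapunov C psi g P (x s).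
  move=> sol s t sI tI st; have := decay I x sol s t 0 sI tI st.
  rewrite mulr0 mul0r addr0; apply => r _ _.
  by apply: sumr_ge0 => i _; exact: sqr_ge0.
split.
- move=> [lo hi] x [sol mx] t /= t0; have [I0 _] := sol.
  have l0' : (lo <= BLeft 0)%O by move: I0; rewrite itv_boundlr => /andP[].
  rewrite itv_boundlr (le_trans l0') ?bnd_simp//=.
  (* The right end is missing at [T], attained at [T], minus infinity, which [0 \in I] excludes, or
     plus infinity, where nothing is left to prove. *)
  case: hi sol mx I0 => [[] T|[]] sol mx I0 //.
  (* V does not increase and dominates [l] times |x|^2, which confines the solution to this
     radius. *)
  + pose K := Num.sqrt (lyapunov C psi g P (x 0) / l).
    have [|z solz zx] := solution_extend_open R n p A B C psi lo T K x pcf (sqrtr_ge0 _) _ sol.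
      move=> s s0 sT i.
      have sI : s \in Interval lo (BLeft T).
        by rewrite itv_boundlr (le_trans l0') ?bnd_simp.
      apply: (le_trans (comp_le_vnorm R n (x s) i)); apply: ler_wsqrtr.
      rewrite ler_pdivlMr// mulrC; apply: (le_trans (Vlow _)).
      exact: Vdec sol _ _ I0 sI s0.
    have HJ := mx (Interval lo (BRight T)) z solz.
    have T0 : 0 < T by move: I0; rewrite itv_boundlr => /andP[_ /=]; rewrite bnd_simp.
    have : [set` Interval lo (BRight T)] T.
      by rewrite /= itv_boundlr (le_trans l0') ?bnd_simp ?ltW.
    rewrite HJ.
    * by rewrite /= itv_boundlr => /andP[_ /=]; rewrite bnd_simp ltxx.
    * move=> s /=; rewrite !itv_boundlr => /andP[-> /=]; rewrite !bnd_simp; exact: ltW.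
    * by move=> s; rewrite itv_boundlr => /andP[_ /=]; rewrite bnd_simp; exact: zx.
  + have [h h0 [z solz zx]] := solution_extend_closed R n p A B C psi lo T x pcf sol.
    have HJ := mx (Interval lo (BRight (T + h))) z solz.
    have T0 : 0 <= T by move: I0; rewrite itv_boundlr => /andP[_ /=]; rewrite bnd_simp.
    have : [set` Interval lo (BRight (T + h))] (T + h).
      rewrite /= itv_boundlr (le_trans l0') ?bnd_simp//; lra.
    rewrite HJ.
    * have hT : (T + h <= T) = false by apply/negbTE; rewrite -ltNge; lra.
      by rewrite /= itv_boundlr !bnd_simp hT andbF.
    * move=> s /=; rewrite !itv_boundlr => /andP[-> /=]; rewrite !bnd_simp; lra.
    * by move=> s; rewrite itv_boundlr => /andP[_ /=]; rewrite bnd_simp; exact: zx.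
  + by move: I0; rewrite itv_boundlr => /andP[_ /=].
- have [a [ca a0 incr Vup]] := lyapunov_upper R n p C psi g P pcf sgn g0.
  exists (kl_bound a eta l); split; first exact: kl_bound_classKL.
  move=> I x sol t tI t0; have [I0 _] := sol.
  set r := vnorm (x 0).
  pose Q := (a r / eta + r ^+ 2) / (1 + t).
  have t1 : 0 < 1 + t by lra.
  have mono u v : 0 <= u -> u <= v -> a u <= a v.
    by move=> u0; rewrite le_eqVlt => /orP[/eqP->//|uv]; exact/ltW/incr.
  (* If |x|^2 stayed above [Q] on [[0, t]], the decay would give [Q * t <= a r / eta], and time 0
     gives [Q < r ^+ 2]; the sum contradicts the choice of [Q]. The contribution of time 0 keeps the
     bound finite at [t = 0]. *)
  have [s [s0 st sQ]] : exists s, [/\ 0 <= s, s <= t & \sum_i (x s i 0) ^+ 2 <= Q].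
    apply: contrapT => H.
    have HQ s : 0 <= s -> s <= t -> Q < \sum_i (x s i 0) ^+ 2.
      by move=> s0 st; rewrite ltNge; apply/negP => sQ; apply: H; exists s.
    have := decay I x sol 0 t Q I0 tI t0 (fun s s0 st => ltW (HQ s s0 st)).
    rewrite subr0 => D.
    have V0 : 0 <= lyapunov C psi g P (x t).
      by apply: le_trans (Vlow _); rewrite mulr_ge0 ?(ltW l0)// sumr_ge0// => i _; exact: sqr_ge0.
    have D' : eta * Q * t <= a r.
      rewrite -[_ * t]add0r; apply: (le_trans (lerD V0 (lexx _))).
      exact: le_trans D (Vup _).
    have r2 : Q < r ^+ 2 by rewrite vnorm_sqr; exact: HQ.
    have QE : Q * (1 + t) = a r / eta + r ^+ 2 by rewrite /Q divfK// gt_eqF.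
    have : Q * t <= a r / eta by rewrite ler_pdivlMr// mulrC mulrA.
    lra.
  have sI : s \in I by exact: mem_itv_between I0 tI s0 st.
  rewrite /kl_bound /vnorm; apply: ler_wsqrtr.
  rewrite ler_pdivlMr// mulrC; apply: (le_trans (Vlow _)).
  apply: (le_trans (Vdec I x sol s t sI tI st)); apply: (le_trans (Vup _)).
  apply: mono; first exact: vnorm_ge0.
  exact: ler_wsqrtr.
Qed.
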